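(* Maintaining strong components via topological search takes $\mathrm{O}(n^{5/2})$ total time over all arc additions.
   Context: Incremental setting: $n$ fixed vertices, initially no arcs; distinct arcs added one at a time. Maintain the partition into strongly connected components, each with a canonical vertex, $f(x)$ denoting the canonical vertex of $x$'s component (disjoint-set structure; finds/unites $\mathrm{O}(1)$ amortized). The canonical vertices are numbered consecutively from 1 by a bijection $\mathit{position}$ with inverse array $\mathit{vertex}$, in a topological order of the graph of components. An adjacency matrix $A$ indexed by canonical vertices has $A(x,y)=1$ iff $x\ne y$ and some arc $(q,r)$ has $f(q)=x$, $f(r)=y$. Adding arc $(v,w)$: set $A(f(v),f(w))=1$ (when $f(v)\ne f(w)$). If $\mathit{position}(f(v))>\mathit{position}(f(w))$, run topological search on canonical vertices with $v,w$ replaced by $f(v),f(w)$: $F=[f(w)]$, $B=[f(v)]$ (queues), $i=\mathit{position}(f(w))$, $j=\mathit{position}(f(v))$, $\mathit{vertex}(i)=\mathit{vertex}(j)=$ null; repeat: $i=i+1$, while $i<j$ and no $u\in F$ has $A(u,\mathit{vertex}(i))=1$, $i=i+1$; if $i=j$ stop, else append $\mathit{vertex}(i)$ to $F$ and set it null; $j=j-1$, while $i<j$ and no $z\in B$ has $A(\mathit{vertex}(j),z)=1$, $j=j-1$; if $i=j$ stop, else append $\mathit{vertex}(j)$ to $B$ and set it null. Let $k$ be the final common value of $i,j$. Find the new component, if any, by a linear-time static strong-components computation on the graph with vertex set $F\cup B$ and arcs $(x,y)$ with $A(x,y)=1$. Then reorder: while $F$ nonempty: if $\mathit{vertex}(i)\ne$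 null and $A(u,\mathit{vertex}(i))=1$ for some $u$ currently in $F$, append it to $F$ and set $\mathit{vertex}(i)=$ null; if $\mathit{vertex}(i)=$ null, pop $x$ from $F$, set $\mathit{vertex}(i)=x$, $\mathit{position}(x)=i$; $i=i+1$. While $B$ nonempty: $j=j-1$; if $\mathit{vertex}(j)\ne$ null and $A(\mathit{vertex}(j),z)=1$ for some $z$ currently in $B$, append it to $B$ and set $\mathit{vertex}(j)=$ null; if $\mathit{vertex}(j)=$ null, pop $y$ from $B$, set $\mathit{vertex}(j)=y$, $\mathit{position}(y)=j$. If there is a new component: combine the vertex sets of the old components it contains, make $\mathit{vertex}(k)$ its canonical vertex, combine the rows and columns of $A$ of the old components into one row and column, delete the no-longer-canonical vertices from the order, and renumber the remaining canonical vertices consecutively from 1. *)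

(* Defs.v *)
From mathcomp Require Import all_boot all_fingroup.

Set Implicit Arguments.
Unset Strict Implicit.
Unset Printing Implicit Defensive.

(* Time is counted in unit-cost elementary operations.  A loop is given by its
   body, which maps the current state to the time taken by this iteration
   together with either the next state ([inl]) or the final result ([inr]);
   [loop body s t r] says that the loop started in [s] halts with result [r]
   after total time [t]. *)
Inductive loop (S T : Type) (body : S -> nat * (S + T)) : S -> nat -> T -> Prop :=
| LoopStop s t r : body s = (t, inr r) -> loop body s t r
| LoopNext s t s' t' r :
    body s = (t, inl s') -> loop body s' t' r -> loop body s (t + t') r.

Definition update (T : eqType) (U : Type) (g : T -> U) (x : T) (y : U) : T -> U :=
  fun z => if z == x then y else g z.

Section StronglyConnected.
Variables (V : finType) (S : seq V) (E : rel V).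

Definition induced : rel V := [rel x y | [&& x \in S, y \in S & E x y]].

Definition strongly_connected (x y : V) : bool :=
  connect induced x y && connect induced y x.

Definition num_arcs : nat := #|[set e : V * V | induced e.1 e.2]|.

End StronglyConnected.

(* [scc S E] is the output (the list of strong components) and the running time
   of a static algorithm on the graph with vertex set [S] and arcs [E]. *)
Definition linear_time_scc (c : nat) (V : finType)
    (scc : seq V -> rel V -> seq (seq V) * nat) : Prop :=
  forall (S : seq V) (E : rel V), uniq S ->
  [/\ perm_eq (flatten (scc S E).1) S, [::] \notin (scc S E).1,
      {in S &, forall x y,
         has (fun D => (x \in D) && (y \in D)) (scc S E).1
         = strongly_connected S E x y} &
      (scc S E).2 <= c * (size S + num_arcs S E)].

Section Maintenance.
Variable n : nat.

(* Positions and slots of [vertex] are numbered from 1, and [None] is null.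
   [position] and [adj] are meaningful on canonical vertices only. *)
Record state := State {
  canon : 'I_n -> 'I_n;
  position : 'I_n -> nat;
  vertex : nat -> option 'I_n;
  adj : rel 'I_n }.

(* No arcs yet: singleton components, in an arbitrary order. *)
Definition initial (order : {perm 'I_n}) : state :=
  let pos x := (order x).+1 in
  State id pos (fun i => [pick x | pos x == i]) (fun _ _ => false).

(* Testing [vertex(i)] against a queue probes [A] once per queue element; every
   test is charged the full length of the queue, a scan being allowed to stop
   earlier. *)
Definition hits_from (A : rel 'I_n) (F : seq 'I_n) (o : option 'I_n) : bool :=
  if o is Some x then has (fun u => A u x) F else false.

Definition hits_into (A : rel 'I_n) (B : seq 'I_n) (o : option 'I_n) : bool :=
  if o is Some x then has (fun z => A x z) B else false.

Definition enqueue (o : option 'I_n) (Q : seq 'I_n) : seq 'I_n :=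
  if o is Some x then rcons Q x else Q.

Inductive direction := Forward | Backward.

Record search_state := SearchState {
  dir : direction;
  svertex : nat -> option 'I_n;
  sF : seq 'I_n;
  sB : seq 'I_n;
  si : nat;
  sj : nat }.

(* One test of one of the two inner "while" loops of the search, followed, when
   that loop is exited, by the code up to the next such test.  The result is the
   array [vertex], the queues [F] and [B], and the common value [k] of [i], [j]. *)
Definition search_body (A : rel 'I_n) (s : search_state) :
    nat * (search_state + (nat -> option 'I_n) * seq 'I_n * seq 'I_n * nat) :=
  let: SearchState d vtx F B i j := s in
  match d with
  | Forward =>
    ((size F).+1,
     if (i < j) && ~~ hits_from A F (vtx i) then
       inl (SearchState Forward vtx F B i.+1 j)
     else if i == j then inr (vtx, F, B, i)
     else inl (SearchState Backward (update vtx i None)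
                 (enqueue (vtx i) F) B i j.-1))
  | Backward =>
    ((size B).+1,
     if (i < j) && ~~ hits_into A B (vtx j) then
       inl (SearchState Backward vtx F B i j.-1)
     else if i == j then inr (vtx, F, B, i)
     else inl (SearchState Forward (update vtx j None)
                 F (enqueue (vtx j) B) i.+1 j))
  end.

Definition search_start (vtx : nat -> option 'I_n) (pos : 'I_n -> nat)
    (v w : 'I_n) : search_state :=
  SearchState Forward (update (update vtx (pos w) None) (pos v) None)
    [:: w] [:: v] (pos w).+1 (pos v).

(* (vertex, position, queue, index) *)
Definition reorder_state : Type :=
  (nat -> option 'I_n) * ('I_n -> nat) * seq 'I_n * nat.

(* What both reordering loops do at slot [i], [hit] being the outcome of the
   test of [vertex(i)] against the queue. *)
Definition reorder_slot (hit : bool) (vtx : nat -> option 'I_n)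
    (pos : 'I_n -> nat) (Q : seq 'I_n) (i : nat) :
    (nat -> option 'I_n) * ('I_n -> nat) * seq 'I_n :=
  let: (vtx1, Q1) :=
    if hit then (update vtx i None, enqueue (vtx i) Q) else (vtx, Q) in
  if vtx1 i is None then
    if Q1 is x :: Q2 then
      (update vtx1 i (Some x), update pos x i, Q2)
    else (vtx1, pos, Q1)
  else (vtx1, pos, Q1).

Definition reorderF_body (A : rel 'I_n) (s : reorder_state) :
    nat * (reorder_state + (nat -> option 'I_n) * ('I_n -> nat)) :=
  let: (vtx, pos, F, i) := s in
  ((size F).+1,
   if nilp F then inr (vtx, pos)
   else inl (reorder_slot (hits_from A F (vtx i)) vtx pos F i, i.+1)).

Definition reorderB_body (A : rel 'I_n) (s : reorder_state) :
    nat * (reorder_state + (nat -> option 'I_n) * ('I_n -> nat)) :=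
  let: (vtx, pos, B, j) := s in
  ((size B).+1,
   if nilp B then inr (vtx, pos)
   else inl (reorder_slot (hits_into A B (vtx j.-1)) vtx pos B j.-1, j.-1)).

Variable scc : seq 'I_n -> rel 'I_n -> seq (seq 'I_n) * nat.

(* The old components being single vertices here, a new component is a strong
   component with at least two elements. *)
Definition new_component (S : seq 'I_n) (A : rel 'I_n) : option (seq 'I_n) :=
  ohead [seq D <- (scc S A).1 | 1 < size D].

(* Listing the arcs of the graph on [S] probes [A] once per pair; then comes the
   static computation and the inspection of the components it returns. *)
Definition new_component_time (S : seq 'I_n) (A : rel 'I_n) : nat :=
  size S ^ 2 + (scc S A).2 + size S.

(* Search for [v], [w] canonical with [position v > position w], detection of a
   new component, and reordering; the result is [vertex], [position], the new
   component if any, and [k]. *)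
Inductive search_and_reorder (s : state) (v w : 'I_n) :
    nat -> (nat -> option 'I_n) * ('I_n -> nat) * option (seq 'I_n) * nat ->
    Prop :=
| SearchAndReorder t1 vtx1 F B k t2 vtx2 pos2 t3 vtx3 pos3 :
    loop (search_body (adj s)) (search_start (vertex s) (position s) v w)
      t1 (vtx1, F, B, k) ->
    loop (reorderF_body (adj s)) (vtx1, position s, F, k) t2 (vtx2, pos2) ->
    loop (reorderB_body (adj s)) (vtx2, pos2, B, k) t3 (vtx3, pos3) ->
    search_and_reorder s v w
      (t1 + new_component_time (F ++ B) (adj s) + t2 + t3)
      (vtx3, pos3, new_component (F ++ B) (adj s), k).

(* Combining the components in [D] into one, with canonical vertex [c]. *)
Definition contract (f : 'I_n -> 'I_n) (vtx : nat -> option 'I_n) (A : rel 'I_n)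
    (D : seq 'I_n) (c : 'I_n) : state :=
  let f' x := if f x \in D then c else f x in
  let old x := if x == c then D else [:: x] in
  let A' x y := (x != y) && has (fun x' => has (A x') (old y)) (old x) in
  let order := [seq x <- pmap vtx (iota 1 n) | f' x == x] in
  State f' (fun x => (index x order).+1)
    (fun i => if i is p.+1 then onth order p else None) A'.

(* The unites, one row and one column of length [n] per old component, and a
   scan of the [n] slots for deletion and renumbering. *)
Definition contract_time (D : seq 'I_n) : nat :=
  (size D).-1 + size D * (2 * n) + n.

Definition set_arc (s : state) (x y : 'I_n) : state :=
  State (canon s) (position s) (vertex s)
    (fun a b => ((a == x) && (b == y)) || adj s a b).

(* The additive constants count two finds and a comparison, then the update of
   [A] and the comparison of positions, then the initialization of the search.
   A find or unite is charged its amortized time, 1. *)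
Inductive add_arc (s : state) (v w : 'I_n) : nat -> state -> Prop :=
| AddInside :
    canon s v = canon s w ->
    add_arc s v w 3 s
| AddOrdered :
    canon s v <> canon s w ->
    position s (canon s v) <= position s (canon s w) ->
    add_arc s v w 5 (set_arc s (canon s v) (canon s w))
| AddAcyclic t vtx pos k :
    canon s v <> canon s w ->
    position s (canon s w) < position s (canon s v) ->
    search_and_reorder (set_arc s (canon s v) (canon s w))
      (canon s v) (canon s w) t (vtx, pos, None, k) ->
    add_arc s v w (11 + t)
      (State (canon s) pos vtx (adj (set_arc s (canon s v) (canon s w))))
| AddCyclic t vtx pos k D c :
    canon s v <> canon s w ->
    position s (canon s w) < position s (canon s v) ->
    search_and_reorder (set_arc s (canon s v) (canon s w))
      (canon s v) (canon s w) t (vtx, pos, Some D, k) ->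
    vtx k = Some c ->
    add_arc s v w (11 + t + contract_time D)
      (contract (canon s) vtx (adj (set_arc s (canon s v) (canon s w))) D c).

Inductive add_arcs : state -> seq ('I_n * 'I_n) -> nat -> state -> Prop :=
| AddNil s : add_arcs s [::] 0 s
| AddCons s v w arcs t1 s1 t2 s2 :
    add_arc s v w t1 s1 -> add_arcs s1 arcs t2 s2 ->
    add_arcs s ((v, w) :: arcs) (t1 + t2) s2.

End Maintenance.

(* Main.v *)
(** Every vertex [x] gets a rank compatible with the topological order of the
    components at all times, hence a block number [psi x = rank x %/ q] with
    [q] about [sqrt n].  Write [w] and [v] for the canonical vertices between
    which a search runs.  A search and the reordering that follows it cost
    [O(Theta + |F| * |B|)], where [Theta] is the total distance from [F] and [B] to
    the meeting slot [k].  Vertices moving forward are reachable from [w] and those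
    moving backward reach [v], so outside the new component the moves never
    decrease [sum_x psi x * position x], and they increase it at least in
    proportion to the part of [Theta] due to vertices of [F] and [B] that are not in
    the common block of [v] and [w]; the total increase is [O(n^3 / q)].  The other
    vertices contribute at most [n] each, and all pairs of [B * F] become related
    at this very moment, so that they are paid for by the [O(n q)] pairs inside
    a block.  Contractions are charged to the vertices they delete. *)

Require Import Defs.
From mathcomp Require Import all_boot all_order all_fingroup all_algebra.
From mathcomp Require Import zify.

Set Implicit Arguments.
Unset Strict Implicit.
Unset Printing Implicit Defensive.
Import Order.TTheory GRing.Theory Num.Theory.

(** The rank is chosen in hindsight from the whole sequence of arcs; only the analysis sees it. It
    does not control the order inside a component, so the moves of vertices of a new component may
    lower the weight, by at most [b * n] each. A component formed from [d >= 2] old ones deletes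
    [d - 1 >= d / 2] canonical vertices, so these losses too are charged to deletions.

    As [psi v] and [psi w] may differ, the proof compares [psi x] with their mean: positions stay a
    permutation of the same interval, so shifting all weights by a constant does not change the
    gain. Outside the new component, a vertex moving forward has [psi] at least both values and a
    vertex moving backward at most both, and the gain vanishes only when all three are equal.

    With [b] about [n / q], the weight is worth [n ^ 2 * b] and the related pairs inside blocks
    [n * (n * q)], which balance at [q] about the square root of [n].

    Execution is a relation: one terminating run is built together with its bound, and determinism
    carries the bound over to every run. *)

Lemma loop_det S T (body : S -> nat * (S + T)) s t r t' r' :
  loop body s t r -> loop body s t' r' -> t = t' /\ r = r'.
Proof.
move=> run; elim: run t' r' => {s t r} [s t r e|s t s1 t1 r e _ IH] t' r' run'.
  by case: run' e => [s' t2 r2 ->|s' t2 s2 t3 r2 ->] // [-> ->].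
case: run' e IH => [s' t2 r2 ->|s' t2 s2 t3 r2 -> run'] // [-> <-] IH.
by have [-> ->] := IH _ _ run'.
Qed.

(** This lets one abstract loop, counting slots from 0, stand for the two reordering loops, whose
    indices are [k + i] and [k - i]. *)
Lemma loop_simulation S1 S2 T (body1 : S1 -> nat * (S1 + T))
    (body2 : S2 -> nat * (S2 + T)) (g : S1 -> S2) s t r :
  (forall s, body2 (g s) =
     ((body1 s).1, match (body1 s).2 with inl s' => inl (g s') | inr r => inr r end)) ->
  loop body1 s t r -> loop body2 (g s) t r.
Proof.
move=> body_g; elim=> {s t r} [s t r e|s t s1 t1 r e _ IH].
  by apply: LoopStop; rewrite body_g e.
by apply: LoopNext IH; rewrite body_g e.
Qed.

(** * Reachability after one more arc, and a rank compatible with all intermediate graphs *)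

Section AddArcRelation.
Variable T : finType.
Implicit Types (E : rel T) (v w x y : T).

Definition add_rel E v w : rel T := [rel x y | ((x == v) && (y == w)) || E x y].

Lemma sub_connect E E' x y :
  (forall a b, E a b -> connect E' a b) -> connect E x y -> connect E' x y.
Proof.
move=> sub /connectP[p]; elim: p x => [|z p IH] x /=; first by move=> _ ->.
by case/andP=> /sub xz zp /(IH _ zp); apply: connect_trans.
Qed.

Lemma connect_rel_add E v w x y : connect E x y -> connect (add_rel E v w) x y.
Proof. by apply: sub_connect => a b ab; apply: connect1; apply/orP; right. Qed.

Lemma connect_new_arc E v w : connect (add_rel E v w) v w.
Proof. by apply: connect1; rewrite /add_rel /= !eqxx. Qed.

(** A path using the new arc is cut before its first and after its last use of it. *)
Lemma connect_add_rel E v w x y : connect (add_rel E v w) x y ->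
  connect E x y \/ connect E x v /\ connect E w y.
Proof.
move=> /connectP[p]; elim: p x => [|z p IH] x /=; first by move=> _ ->; left.
case/andP=> xz zp /(IH _ zp) zy; case/orP: xz => [/andP[/eqP-> /eqP zw]|/connect1 xz].
  by move: zy; rewrite zw => -[wy|[_ wy]]; right.
case: zy => [zy|[zv wy]]; first by left; apply: connect_trans xz zy.
by right; split=> //; apply: connect_trans xz zv.
Qed.

(* The ancestor counts of [x] in [G 0], ..., [G l.-1] are read as digits, the last
   graph being the most significant: vertices related at some time stay related,
   so later digits never contradict the order of their components at that time. *)
Fixpoint ancestor_code (G : nat -> rel T) (l : nat) (x : T) : nat :=
  if l is l'.+1 then
    #|[set z | connect (G l') z x]| * #|T|.+1 ^ l' + ancestor_code G l' x
  else 0.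

Lemma ancestors_mono E x y : connect E x y ->
  #|[set z | connect E z x]| <= #|[set z | connect E z y]|.
Proof.
move=> xy; apply/subset_leq_card/subsetP=> z; rewrite !inE => zx.
exact: connect_trans xy.
Qed.

Lemma ancestors_strict E x y : connect E x y -> ~~ connect E y x ->
  #|[set z | connect E z x]| < #|[set z | connect E z y]|.
Proof.
move=> xy yx; apply/proper_card/properP; split.
  by apply/subsetP=> z; rewrite !inE => zx; apply: connect_trans xy.
by exists y; rewrite !inE.
Qed.

Lemma ancestor_code_bound G l x : ancestor_code G l x < #|T|.+1 ^ l.
Proof.
elim: l => //= l IH; rewrite expnS mulSn addnC -addSn; apply: leq_add => //.
by rewrite leq_mul2r max_card orbT.
Qed.

(** At digit [i] the inclusion of ancestor sets is strict; at later digits it is weak. The digits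
    below [i] together are worth less than one unit of digit [i], by [ancestor_code_bound]. *)
Lemma ancestor_code_strict G l i x y :
  (forall j, i <= j -> connect (G j) x y) -> ~~ connect (G i) y x -> i < l ->
  ancestor_code G l x < ancestor_code G l y.
Proof.
move=> xy yx; elim: l => // l IH; rewrite ltnS leq_eqVlt => /orP[/eqP il|il] /=.
  have lt := ancestors_strict (xy i (leqnn i)) yx; rewrite il in lt.
  apply: leq_trans (leq_addr _ _); apply: leq_trans (leq_mul lt (leqnn _)).
  by rewrite mulSn addnC -addSn leq_add2r ancestor_code_bound.
rewrite -addnS; apply: leq_add; last exact: IH.
by rewrite leq_mul2r (ancestors_mono (xy l (ltnW il))) orbT.
Qed.

End AddArcRelation.

Section Rank.
Variables (n : nat) (arcs : seq ('I_n * 'I_n)).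

Definition arc_rel (s : seq ('I_n * 'I_n)) : rel 'I_n := [rel x y | (x, y) \in s].

Lemma connect_arc_rel_take i j x y : i <= j ->
  connect (arc_rel (take i arcs)) x y -> connect (arc_rel (take j arcs)) x y.
Proof.
move=> ij; apply: sub_connect => a b /= ab; apply: connect1 => /=.
by move: ab; rewrite -(take_takel arcs ij); apply: mem_take.
Qed.

(** The codes already have the right order; counting the smaller codes brings them below [n]. The
    list [past] has its newest arc first, whence [catrev]. *)
Lemma topological_rank : exists r : 'I_n -> nat,
  [/\ injective r, forall x, r x < n &
  forall past future x y, catrev past future = arcs ->
    connect (arc_rel past) x y -> ~~ connect (arc_rel past) y x -> r x < r y].
Proof.
(* There is one digit per prefix of [arcs], the empty and the full one included. The summand [x < n]
   breaks ties, so that codes are distinct. *)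
pose code (x : 'I_n) :=
  x + n * ancestor_code (fun i => arc_rel (take i arcs)) (size arcs).+1 x.
have code_inj : injective code.
  move=> x y; rewrite /code => e; apply/val_inj/eqP => /=.
  have := congr1 (fun m => m %% n) e.
  by rewrite !(addnC _ (n * _)) !(mulnC n) !modnMDl !modn_small // => ->.
have code_strict i x y : connect (arc_rel (take i arcs)) x y ->
    ~~ connect (arc_rel (take i arcs)) y x -> code x < code y.
  wlog i_le : i / i <= size arcs.
    move=> H; case: (leqP i (size arcs)) => [|lt]; first exact: H.
    rewrite (take_oversize (ltnW lt)) -[in X in X -> _](take_size arcs).
    by rewrite -[in X in _ -> X](take_size arcs); apply: H.
  move=> xy yx; rewrite /code.
  have : ancestor_code (fun i => arc_rel (take i arcs)) (size arcs).+1 x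
       < ancestor_code (fun i => arc_rel (take i arcs)) (size arcs).+1 y.
    apply: (@ancestor_code_strict _ _ _ i) => // j ij.
    exact: connect_arc_rel_take xy.
  by move: (ancestor_code _ _ x) (ancestor_code _ _ y) (ltn_ord x) => p q; nia.
pose r x := #|[set z | code z < code x]|.
have r_mono x y : code x < code y -> r x < r y.
  move=> xy; apply/proper_card/properP; split.
    by apply/subsetP=> z; rewrite !inE => /ltn_trans; apply.
  by exists x; rewrite !inE ?ltnn.
exists r; split=> [x y e|x|past future x y arcsE xy yx]; last first.
  have eq_past : arc_rel past =2 arc_rel (take (size past) arcs).
    move=> a b; rewrite -arcsE catrevE take_size_cat ?size_rev //.
    exact/esym/mem_rev.
  by apply/r_mono/(code_strict (size past)); rewrite -!(eq_connect eq_past) ?xy.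
- rewrite -[n in _ < n]card_ord -cardsT; apply/proper_card/properP; split=> //.
  by exists x; rewrite !inE ?ltnn.
- by apply: code_inj; case: (ltngtP (code x) (code y)) => // /r_mono; rewrite e ltnn.
Qed.

End Rank.

(** An injection into an interval of the same size is onto. It applies to the positions before and
    after a reordering, which therefore have the same sum. *)
Lemma perm_image_iota (T : finType) (L : pred T) (f : T -> nat) :
  (forall x y, L x -> L y -> f x = f y -> x = y) ->
  (forall x, L x -> 0 < f x <= #|L|) ->
  perm_eq [seq f x | x in L] (iota 1 #|L|).
Proof.
move=> f_inj f_range; have u : uniq [seq f x | x in L].
  by rewrite map_inj_in_uniq ?enum_uniq // => x y; rewrite !mem_enum; apply: f_inj.
have sub : {subset [seq f x | x in L] <= iota 1 #|L|}.
  move=> p /mapP[x]; rewrite mem_enum => Lx ->; rewrite mem_iota.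
  by have := f_range x Lx; lia.
have [] := uniq_min_size u sub; first by rewrite size_iota size_map -cardE.
by move=> _ same; apply: uniq_perm; rewrite ?iota_uniq.
Qed.

(** * Invariants of the maintained state *)

Section Validity.
Variable n : nat.

Definition live (s : state n) : pred 'I_n := [pred x | canon s x == x].

(** Only two facts about [adj] are kept: it covers the arcs between components, and its entries
    imply reachability. Rows and columns of deleted vertices are stale, hence the guards [live].
    Acyclicity of the graph of components is implicit in [position_topological]. *)
Record valid (E : rel 'I_n) (s : state n) : Prop := Valid {
  canonK : forall x, canon s (canon s x) = canon s x;
  canon_connect : forall x, connect E x (canon s x) && connect E (canon s x) x;
  arc_adj : forall x y, E x y ->
    canon s x = canon s y \/ adj s (canon s x) (canon s y);
  adj_connect : forall x y, live s x -> live s y -> adj s x y -> connect E x y;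
  vertexP : forall p x, vertex s p = Some x <-> live s x /\ position s x = p;
  position_range : forall x, live s x -> 0 < position s x <= #|live s|;
  position_topological : forall x y, live s x -> live s y -> adj s x y ->
    position s x < position s y }.

Definition live_arc (s : state n) : rel 'I_n :=
  [rel x y | [&& live s x, live s y & adj s x y]].

(* [Q] is one of the two search queues: it contains exactly the vertices found
   from [root] along [arc] among the slots before [bound] in the order [lt]. *)
Record search_side (s : state n) (arc : rel 'I_n) (reach : pred 'I_n)
    (lt : rel nat) (root : 'I_n) (Q : seq 'I_n) (bound : nat) : Prop := SearchSide {
  side_uniq : uniq Q;
  side_root : exists Q', Q = root :: Q';
  side_mem : forall x, x \in Q ->
    [/\ live s x, reach x & lt (position s x) bound];
  side_sorted : pairwise (relpre (position s) lt) Q;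
  side_complete : forall u x, u \in Q -> arc u x -> lt (position s x) bound ->
    x \in Q }.

Section Live.
Variables (E : rel 'I_n) (s : state n).
Hypothesis sV : valid E s.

Lemma position_inj x y :
  live s x -> live s y -> position s x = position s y -> x = y.
Proof.
move=> Lx Ly xy.
have /(vertexP sV) ex : live s x /\ position s x = position s y by [].
have /(vertexP sV) ey : live s y /\ position s y = position s y by [].
by move: ex; rewrite ey => -[].
Qed.

Lemma live_canon x : live s (canon s x).
Proof. by rewrite /live /= (canonK sV). Qed.

Lemma positions_perm :
  perm_eq [seq position s x | x in live s] (iota 1 #|live s|).
Proof. exact: (perm_image_iota position_inj (position_range sV)). Qed.

Lemma slot_full p : 0 < p <= #|live s| -> exists2 x, live s x & position s x = p.
Proof.
move=> p_range; have : p \in iota 1 #|live s| by rewrite mem_iota; lia.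
rewrite -(perm_mem positions_perm) => /mapP[x]; rewrite mem_enum => Lx ->.
by exists x.
Qed.

Lemma connect_live_arc x y :
  connect E x y -> connect (live_arc s) (canon s x) (canon s y).
Proof.
move=> /connectP[p]; elim: p x => [|z p IH] x /=; first by move=> _ ->.
case/andP=> xz zp /(IH _ zp); apply: connect_trans.
case: (arc_adj sV xz) => [->|a]; first exact: connect0.
by apply: connect1; rewrite /live_arc /= !live_canon.
Qed.

Lemma live_arc_connect x y : live_arc s x y -> connect E x y.
Proof. by case/and3P; apply: adj_connect sV _ _. Qed.

Lemma live_arc_position x y : live_arc s x y -> position s x < position s y.
Proof. by case/and3P; apply: position_topological sV _ _. Qed.

Lemma connect_live x y : live s x -> live s y ->
  connect E x y -> connect (live_arc s) x y.
Proof. by move=> /eqP {2}<- /eqP {2}<-; apply: connect_live_arc. Qed.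

Lemma connect_position x y : live s x -> live s y -> connect E x y ->
  x = y \/ position s x < position s y.
Proof.
move=> Lx Ly /(connect_live Lx Ly)/connectP[p].
elim: p x Lx => [|z p IH] x Lx /=; first by move=> _ ->; left.
case/andP=> xz zp e; right; have := live_arc_position xz.
have Lz : live s z by case/and3P: xz.
by case: (IH z Lz zp e) => [->//|zy xz_lt]; apply: ltn_trans zy.
Qed.

Lemma mutual_live x y : live s x -> live s y -> connect E x y -> connect E y x -> x = y.
Proof.
move=> Lx Ly /(connect_position Lx Ly)[//|xy] /(connect_position Ly Lx)[//|]; lia.
Qed.

(** With [lt] equal to [ltn] or [gtn], this lemma and the next serve both directions of the search;
    [a'] is the bound that follows [a] in the direction of travel. *)
Lemma side_skip arc reach lt root Q a a' :
  search_side s arc reach lt root Q a ->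
  (forall p, lt p a' = lt p a || (p == a)) ->
  (forall u x, u \in Q -> arc u x -> position s x != a) ->
  search_side s arc reach lt root Q a'.
Proof.
move=> [Qu Qr Qm Qs Qc] aS nhit; split=> // [x /Qm[-> ->] lt_xa|u x uQ ux].
  by rewrite aS lt_xa.
by rewrite aS (negPf (nhit _ _ uQ ux)) orbF; apply: Qc ux.
Qed.

Lemma side_enqueue arc reach lt root Q a a' u0 x0 :
  search_side s arc reach lt root Q a ->
  irreflexive lt ->
  (forall p, lt p a' = lt p a || (p == a)) ->
  (forall p, lt a p -> ~~ lt p a') ->
  (forall u x, arc u x -> [/\ live s x, lt (position s u) (position s x)
                            & reach u -> reach x]) ->
  u0 \in Q -> arc u0 x0 -> position s x0 = a ->
  search_side s arc reach lt root (rcons Q x0) a'.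
Proof.
move=> [Qu [Q' eQ] Qm Qs Qc] lt_irr aS aN arcP u0Q u0x0 x0a.
have [Lx0 _ rx0] := arcP _ _ u0x0.
have x0Q : x0 \notin Q by apply/negP=> /Qm[_ _]; rewrite x0a lt_irr.
split.
- by rewrite rcons_uniq x0Q.
- by exists (rcons Q' x0); rewrite eQ.
- move=> x; rewrite mem_rcons inE => /predU1P[->|/Qm[-> -> lt_xa]].
    by split=> //; [apply: rx0; case: (Qm _ u0Q)|rewrite aS x0a eqxx orbT].
  by rewrite aS lt_xa.
- rewrite pairwise_rcons Qs andbT; apply/allP=> x /Qm[_ _] /=.
  by rewrite x0a.
- move=> u x; rewrite !mem_rcons !inE => /predU1P[->|uQ] ux.
    have [_ + _] := arcP _ _ ux; rewrite x0a => /aN /negPf-> //.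
  rewrite aS => /orP[lt_xa|/eqP xa]; first by rewrite (Qc _ _ uQ ux lt_xa) orbT.
  have [Lx _ _] := arcP _ _ ux.
  by rewrite (position_inj Lx Lx0) ?eqxx // xa x0a.
Qed.

End Live.
End Validity.

(** * Search *)

Section Search.
Variables (n : nat) (E : rel 'I_n) (s : state n) (v w : 'I_n).
Hypotheses (sV : valid E s) (Lv : live s v) (Lw : live s w).
Hypothesis wv : position s w < position s v.

Notation pos := (position s).
Let A := adj (set_arc s v w).

Definition forward_side :=
  search_side s (live_arc s) (connect E w) ltn w.
Definition backward_side :=
  search_side s (fun z x => live_arc s x z) (fun x => connect E x v) gtn v.

Definition search_vertex (vtx : nat -> option 'I_n) (F B : seq 'I_n) :=
  forall p x, vtx p = Some x <-> [/\ live s x, x \notin F, x \notin B & pos x = p].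

(** The total distance from a queue to its bound. Moving the bound by one slot raises it by the
    length of the queue, which up to a constant factor is the time of one test. *)
Definition thetaF (F : seq 'I_n) (a : nat) := \sum_(u <- F) (a - pos u).
Definition thetaB (B : seq 'I_n) (b : nat) := \sum_(z <- B) (pos z - b).

Lemma thetaF_step F a :
  forward_side F a -> thetaF F a.+1 = thetaF F a + size F.
Proof.
case=> _ _ m _ _; rewrite /thetaF -sum1_size -big_split /= !big_seq.
by apply: eq_bigr => u /m[_ _]; lia.
Qed.

Lemma thetaB_step B b : 0 < b ->
  backward_side B b -> thetaB B b.-1 = thetaB B b + size B.
Proof.
move=> b_gt0 [_ _ m _ _]; rewrite /thetaB -sum1_size -big_split /= !big_seq.
by apply: eq_bigr => u /m[_ _] /=; lia.
Qed.

Lemma search_null vtx F B x : search_vertex vtx F B ->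
  x \in F \/ x \in B -> live s x -> vtx (pos x) = None.
Proof.
move=> vtxP xFB Lx; case e: (vtx (pos x)) => [y|] //.
case/vtxP: e => Ly yF yB /(position_inj sV Ly Lx) yx.
by move: yF yB; rewrite yx; case: xFB => ->.
Qed.

Lemma search_vertex_enqueue vtx F B F' B' x : search_vertex vtx F B ->
  live s x -> (forall y, (y \notin F') && (y \notin B') = [&& y != x, y \notin F & y \notin B]) ->
  search_vertex (update vtx (pos x) None) F' B'.
Proof.
move=> vtxP Lx mem' p y; rewrite /update; have := mem' y; split.
  case: eqP => // px /vtxP[Ly yF yB yp].
  have yx : y != x by apply/eqP => yx; apply: px; rewrite -yp yx.
  by move: H; rewrite yx yF yB => /andP[-> ->].
case=> Ly y1 y2 yp; move: H; rewrite y1 y2 => /esym/and3P[yx yF yB].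
case: eqP => [px|_]; last exact/vtxP.
by rewrite px in yp; rewrite (position_inj sV Ly Lx yp) eqxx in yx.
Qed.

(* The slots not yet examined are [i + e], ..., [j + e - 1]. *)
Lemma search_loop N d vtx F B i j :
  let e : nat := if d is Forward then 0 else 1 in
  j = i + N -> 0 < i -> j <= #|live s| -> size F = size B + e ->
  forward_side F (i + e) -> backward_side B (j + e).-1 -> search_vertex vtx F B ->
  vtx (if d is Forward then j else i) = None ->
  exists t vtx' F' B' k (e' : bool),
    [/\ loop (search_body A) (SearchState d vtx F B i j) t (vtx', F', B', k),
        0 < k <= #|live s| /\ size F' = size B' + e',
        forward_side F' (k + e') /\ backward_side B' (k + e').-1,
        search_vertex vtx' F' B' /\ vtx' k = None &
        t + 2 * (thetaF F (i + e) + thetaB B (j + e).-1) <=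
        2 * (thetaF F' (k + e') + thetaB B' (k + e').-1) + size F' + 1].
Proof.
(* The factor 2 comes from [(size Q).+1 <= 2 * size Q] for a nonempty queue [Q]. The last test moves
   no bound and is covered by the separate term [size F' + 1]. *)
elim: N d vtx F B i j => [|N IH] d vtx F B i j /= ij i_gt0 jm sz sideF sideB vtxP vtxN.
  rewrite addn0 in ij; subst j.
  exists (if d is Forward then (size F).+1 else (size B).+1), vtx, F, B, i.
  exists (if d is Forward then false else true).
  case: d sz sideF sideB vtxN => /= sz sideF sideB vtxN; split=> //; try lia;
    by apply: LoopStop; rewrite /= ltnn eqxx.
have slot p : i + (if d is Forward then 0 else 1) <= p -> p <= (j + (if d is Forward then 0 else 1)).-1 ->
    exists2 x, vtx p = Some x & [/\ live s x, x \notin F, x \notin B & pos x = p].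
  move=> ip pj; have [|x Lx xp] := @slot_full _ _ _ sV p; first by case: (d) ip pj => /=; lia.
  exists x; last split=> //.
  - apply/vtxP; split=> //.
    + by apply/negP=> /(side_mem sideF)[_ _]; rewrite xp /=; lia.
    + by apply/negP=> /(side_mem sideB)[_ _]; rewrite xp /=; lia.
  - by apply/negP=> /(side_mem sideF)[_ _]; rewrite xp /=; lia.
  - by apply/negP=> /(side_mem sideB)[_ _]; rewrite xp /=; lia.
have wF : w \in F by have [F' ->] := side_root sideF; rewrite inE eqxx.
have vB : v \in B by have [B' ->] := side_root sideB; rewrite inE eqxx.
have arcF u x : live_arc s u x -> [/\ live s x, pos u < pos x & connect E w u -> connect E w x].
  move=> ux; split; [by case/and3P: ux|exact: live_arc_position sV _ _ ux|].
  by move=> wu; apply: connect_trans wu (live_arc_connect sV ux).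
have arcB z x : live_arc s x z -> [/\ live s x, pos z > pos x & connect E z v -> connect E x v].
  move=> xz; split; [by case/and3P: xz|exact: live_arc_position sV _ _ xz|].
  by move=> zv; apply: connect_trans (live_arc_connect sV xz) zv.
have lt_ij : i < j by rewrite ij addnS ltnS leq_addr.
have neq_ij : (i == j) = false by rewrite ltn_eqF.
case: d sz sideF sideB slot vtxN => /=; rewrite ?addn0 ?addn1 => sz sideF sideB slot vtxN.
  have ij1 : i <= j.-1 by clear -lt_ij; lia.
  have [x vx [Lx xF xB xi]] := slot i (leqnn _) ij1.
  (* The new arc enters [w], which is already queued, so it never causes a hit: the search sees the
     old acyclic graph. Dually for [v] in the backward case. *)
  have hits : hits_from A F (vtx i) = has (fun u => live_arc s u x) F.
    rewrite vx /=; apply: eq_in_has => u uF; have [Lu _ _] := side_mem sideF uF.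
    have /negPf xw : x != w by apply: contraNneq xF => ->.
    by rewrite /A /= xw andbF /live_arc /= Lu Lx.
  have body : search_body A (SearchState Forward vtx F B i j) =
     ((size F).+1, inl (if has (fun u => live_arc s u x) F
       then SearchState Backward (update vtx i None) (rcons F x) B i j.-1
       else SearchState Forward vtx F B i.+1 j)).
    by rewrite /= hits lt_ij neq_ij vx /=; case: has.
  have step p : (p < i.+1) = (p < i) || (p == i) by rewrite ltnS leq_eqVlt orbC.
  have tF := thetaF_step sideF.
  have szF : 0 < size F by case: (F) wF.
  case: (boolP (has _ F)) body => [/hasP[u uF ux]|/hasPn nhit] body.
    have sideF' : forward_side (rcons F x) i.+1.
      by apply: (side_enqueue sV sideF) ux xi => // p ip; rewrite -leqNgt.
    have vtxP' : search_vertex (update vtx i None) (rcons F x) B.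
      rewrite -xi; apply: search_vertex_enqueue vtxP Lx _ => y.
      by rewrite mem_rcons inE negb_or andbA.
    have ts : thetaF (rcons F x) i.+1 = (thetaF F i.+1).+1.
      by rewrite /thetaF -cats1 big_cat big_seq1 /= xi subSnn addn1.
    have ij' : j.-1 = i + N by rewrite ij addnS.
    have jm' : j.-1 <= #|live s| := leq_trans (leq_pred j) jm.
    have sz' : size (rcons F x) = size B + 1 by rewrite size_rcons sz addn1.
    have := IH Backward (update vtx i None) (rcons F x) B i j.-1 ij' i_gt0 jm' sz'.
    rewrite !addn1 /= => /(_ sideF' sideB vtxP'); rewrite /update eqxx => /(_ erefl).
    move=> [t [vtx' [F' [B' [k [e' [run range sides vP time]]]]]]].
    exists ((size F).+1 + t), vtx', F', B', k, e'; split=> //.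
      exact: LoopNext body run.
    by clear -time ts tF szF; lia.
  have sideF' : forward_side F i.+1.
    apply: side_skip sideF step _ => u y uF uy; apply/eqP => yi.
    have Ly : live s y by case/and3P: uy.
    by have := nhit _ uF; rewrite -(position_inj sV Ly Lx) ?uy ?yi.
  have ij' : j = i.+1 + N by rewrite ij addnS.
  have := IH Forward vtx F B i.+1 j ij' isT jm.
  rewrite !addn0 /= => /(_ sz sideF' sideB vtxP vtxN).
  move=> [t [vtx' [F' [B' [k [e' [run range sides vP time]]]]]]].
  exists ((size F).+1 + t), vtx', F', B', k, e'; split=> //.
    exact: LoopNext body run.
  by clear -time tF szF; lia.
have [x vx [Lx xF xB xj]] := slot j lt_ij (leqnn _).
have hits : hits_into A B (vtx j) = has (fun z => live_arc s x z) B.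
  rewrite vx /=; apply: eq_in_has => z zB; have [Lz _ _] := side_mem sideB zB.
  have /negPf xv : x != v by apply: contraNneq xB => ->.
  by rewrite /A /= xv /live_arc /= Lz Lx.
have body : search_body A (SearchState Backward vtx F B i j) =
   ((size B).+1, inl (if has (fun z => live_arc s x z) B
     then SearchState Forward (update vtx j None) F (rcons B x) i.+1 j
     else SearchState Backward vtx F B i j.-1)).
  by rewrite /= hits lt_ij neq_ij vx /=; case: has.
have j_gt0 : 0 < j by apply: leq_ltn_trans lt_ij.
have step p : (j.-1 < p) = (j < p) || (p == j).
  by rewrite prednK // leq_eqVlt orbC eq_sym.
have tB : thetaB B j.-1 = thetaB B j + size B by apply: thetaB_step sideB.
have szB : 0 < size B by case: (B) vB.
case: (boolP (has _ B)) body => [/hasP[u uB xu]|/hasPn nhit] body.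
  have sideB' : backward_side (rcons B x) j.-1.
    apply: (side_enqueue sV sideB (x0 := x) (u0 := u)) => //= [p|p pj].
      exact: ltnn.
    by rewrite -leqNgt; clear -pj; lia.
  have vtxP' : search_vertex (update vtx j None) F (rcons B x).
    rewrite -xj; apply: search_vertex_enqueue vtxP Lx _ => y.
    by rewrite mem_rcons inE negb_or andbCA.
  have ts : thetaB (rcons B x) j.-1 = (thetaB B j.-1).+1.
    by rewrite /thetaB -cats1 big_cat big_seq1 /= xj; clear -j_gt0; lia.
  have ij' : j = i.+1 + N by rewrite ij addnS.
  have sz' : size F = size (rcons B x) + 0 by rewrite size_rcons sz; clear; lia.
  have := IH Forward (update vtx j None) F (rcons B x) i.+1 j ij' isT jm sz'.
  rewrite !addn0 /= => /(_ sideF sideB' vtxP'); rewrite /update eqxx => /(_ erefl).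
  move=> [t [vtx' [F' [B' [k [e' [run range sides vP time]]]]]]].
  exists ((size B).+1 + t), vtx', F', B', k, e'; split=> //.
    exact: LoopNext body run.
  by clear -time ts tB szB; lia.
have sideB' : backward_side B j.-1.
  apply: side_skip sideB step _ => u y uB yu; apply/eqP => yj.
  have Ly : live s y by case/and3P: yu.
  by have := nhit _ uB; rewrite -(position_inj sV Ly Lx) ?yu ?yj.
have ij' : j.-1 = i + N by rewrite ij addnS.
have jm' : j.-1 <= #|live s| := leq_trans (leq_pred j) jm.
have := IH Backward vtx F B i j.-1 ij' i_gt0 jm'.
rewrite !addn1 /= => /(_ sz sideF sideB' vtxP vtxN).
move=> [t [vtx' [F' [B' [k [e' [run range sides vP time]]]]]]].
exists ((size B).+1 + t), vtx', F', B', k, e'; split=> //.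
  exact: LoopNext body run.
by clear -time tB szB; lia.
Qed.

End Search.

(** * Reordering *)

Section Reorder.
Variables (n : nat) (S P : pred 'I_n) (H R : rel 'I_n).
Variables (rho : nat -> int) (sigma : nat -> nat) (T : nat).
Variables (pos0 : 'I_n -> nat) (Q0 : seq 'I_n).
Hypothesis rho_inj : injective rho.
Hypothesis rho_sigma : forall i, i <= T -> rho (sigma i) = Posz i.
Hypothesis R_H : forall x y, S x -> S y -> R x y -> H x y.
Hypothesis H_P : forall x y, S x -> S y -> P x -> H x y -> P y.

Definition hit (Q : seq 'I_n) (o : option 'I_n) : bool :=
  if o is Some x then has (fun u => H u x) Q else false.

(** Both reordering loops at once: [sigma i] is the [i]-th slot visited, and [rho p] is the signed
    distance from the first visited slot to [p] in the direction of travel. Hits are tested along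
    [H], but only the order along [R] is claimed, since arcs inside a new component cannot all be
    respected. *)
Definition reorder_body (st : reorder_state n) :
    nat * (reorder_state n + (nat -> option 'I_n) * ('I_n -> nat)) :=
  let: (vtx, pos, Q, i) := st in
  ((size Q).+1,
   if nilp Q then inr (vtx, pos)
   else inl (reorder_slot (hit Q (vtx (sigma i))) vtx pos Q (sigma i), i.+1)).

(* The order being built is: the vertices in slots before [sigma i], then the
   queue, then the remaining vertices; it is compatible with [R] throughout. *)
Record reorder_inv (vtx : nat -> option 'I_n) (pos : 'I_n -> nat)
    (Q : seq 'I_n) (i : nat) : Prop := ReorderInv {
  queue_uniq : uniq Q;
  queue_mem : forall x, x \in Q ->
    [/\ S x, P x, x \in Q0 \/ (0 <= rho (pos0 x))%R & (rho (pos0 x) <= Posz i)%R];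
  slotP : forall p x, vtx p = Some x <-> [/\ S x, x \notin Q & pos x = p];
  size_null : size Q = \sum_(i <= l < T) ~~ vtx (sigma l);
  pos_outside : forall x, ~~ S x -> pos x = pos0 x;
  pos_moved : forall x, S x -> x \notin Q ->
    pos x = pos0 x /\ x \notin Q0 \/
    [/\ P x, x \in Q0 \/ (0 <= rho (pos0 x))%R, (rho (pos0 x) <= rho (pos x))%R
      & exists2 l, l < T & pos x = sigma l];
  order_out : forall x y, S x -> S y -> R x y -> x \notin Q -> y \notin Q ->
    (rho (pos x) < rho (pos y))%R;
  order_queue_out : forall x y, S x -> S y -> R x y -> x \in Q -> y \notin Q ->
    (Posz i <= rho (pos y))%R;
  order_out_queue : forall x y, S x -> S y -> R x y -> x \notin Q -> y \in Q ->
    (rho (pos x) < Posz i)%R;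
  order_queue : forall x y, S x -> S y -> R x y -> x \in Q -> y \in Q ->
    index x Q < index y Q }.

Lemma sigma_inj l i : l <= T -> i <= T -> sigma l = sigma i -> l = i.
Proof.
move=> lT iT /(congr1 rho); rewrite !rho_sigma // => /eqP.
by rewrite eqz_nat => /eqP.
Qed.

Lemma null_update (vtx : nat -> option 'I_n) o i : i < T ->
  \sum_(i.+1 <= l < T) ~~ update vtx (sigma i) o (sigma l) =
  \sum_(i.+1 <= l < T) ~~ vtx (sigma l).
Proof.
move=> iT; apply: eq_big_nat => l /andP[il lT]; rewrite /update.
by case: eqP => // /(sigma_inj (ltnW lT) (ltnW iT)); clear -il; lia.
Qed.

Lemma inv_enqueue vtx pos Q i y u : reorder_inv vtx pos Q i -> i < T ->
  vtx (sigma i) = Some y -> u \in Q -> H u y ->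
  reorder_inv (update vtx (sigma i) None) pos (rcons Q y) i.
Proof.
move=> inv iT vy uQ uy; have /(slotP inv)[Sy yQ yi] := vy.
have ryi : rho (pos y) = Posz i by rewrite yi rho_sigma // ltnW.
have notin x : x \notin rcons Q y -> x != y /\ x \notin Q.
  by rewrite mem_rcons inE negb_or => /andP[].
split.
- by rewrite rcons_uniq yQ (queue_uniq inv).
- move=> x; rewrite mem_rcons inE => /predU1P[->|]; last exact: queue_mem inv _.
  have [Su Pu _ _] := queue_mem inv uQ; have Py := H_P Su Sy Pu uy.
  case: (pos_moved inv Sy yQ) => [[y0 _]|[_ yQ0 y0 _]]; last first.
    by split=> //; rewrite -ryi.
  by split; rewrite -?y0 ?ryi //; right.
- move=> p x; rewrite /update; case: eqP => [->|pi]; split=> //.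
  + case=> Sx /notin[xy xQ] xi; have : vtx (sigma i) = Some x by apply/(slotP inv).
    by rewrite vy => -[/esym /eqP]; rewrite (negPf xy).
  + move=> /(slotP inv)[Sx xQ xp]; split=> //; rewrite mem_rcons inE negb_or xQ andbT.
    by apply/eqP => xy; apply: pi; rewrite -xp xy.
  + by case=> Sx /notin[_ xQ] xp; apply/(slotP inv).
- rewrite size_rcons (size_null inv) !(big_ltn iT) null_update //.
  by rewrite /update eqxx vy.
- exact: pos_outside inv.
- by move=> x Sx /notin[_ xQ]; apply: (pos_moved inv Sx xQ).
- by move=> x z Sx Sz xz /notin[_ xQ] /notin[_ zQ]; apply: (order_out inv Sx Sz xz xQ zQ).
- move=> x z Sx Sz xz; rewrite mem_rcons inE => /predU1P[e|xQ] /notin[_ zQ].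
    by rewrite -ryi ltW //; apply: (order_out inv Sy Sz _ yQ zQ); rewrite -e.
  exact: (order_queue_out inv Sx Sz xz xQ zQ).
- move=> x z Sx Sz xz /notin[_ xQ]; rewrite mem_rcons inE => /predU1P[e|zQ].
    by rewrite -ryi; apply: (order_out inv Sx Sy _ xQ yQ); rewrite -e.
  exact: (order_out_queue inv Sx Sz xz xQ zQ).
- move=> x z Sx Sz xz; rewrite !mem_rcons !inE -cats1 !index_cat.
  move=> /predU1P[e|xQ] /predU1P[e'|zQ].
  + by move: xz; rewrite e e' => yy; have := order_out inv Sy Sy yy yQ yQ; rewrite ltxx.
  + by move: xz; rewrite e => yz; have := order_out_queue inv Sy Sz yz yQ zQ; rewrite ryi ltxx.
  + by rewrite e' xQ (negPf yQ) (leq_trans (_ : index x Q < size Q)) ?index_mem ?leq_addr.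
  + by rewrite xQ zQ; apply: (order_queue inv Sx Sz xz xQ zQ).
Qed.

Lemma inv_pop vtx pos h Q i : reorder_inv vtx pos (h :: Q) i -> i < T ->
  vtx (sigma i) = None ->
  reorder_inv (update vtx (sigma i) (Some h)) (update pos h (sigma i)) Q i.+1.
Proof.
move=> inv iT vN; have /andP[hQ uQ] := queue_uniq inv.
have ri : rho (sigma i) = Posz i by rewrite rho_sigma // ltnW.
have [Sh Ph hQ0 h0] : [/\ S h, P h, h \in Q0 \/ (0 <= rho (pos0 h))%R & (rho (pos0 h) <= Posz i)%R].
  by apply: (queue_mem inv); rewrite inE eqxx.
have hin : h \in h :: Q by rewrite inE eqxx.
have inQ x : x \in Q -> x \in h :: Q by rewrite inE orbC => ->.
have noth x : x \in Q -> (x == h) = false by apply: contraTF => /eqP->.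
have notin x : x != h -> x \notin Q -> x \notin h :: Q by rewrite inE negb_or => -> ->.
have full x : S x -> x \notin h :: Q -> rho (pos x) <> Posz i.
  move=> Sx xQ; rewrite -ri => /rho_inj xi.
  by have /(slotP inv) : [/\ S x, x \notin h :: Q & pos x = sigma i]; rewrite ?vN.
split=> //.
- move=> x xQ; have [Sx Px xQ0 x0] := queue_mem inv (inQ _ xQ); split=> //.
  by apply: le_trans x0 _; rewrite lez_nat.
- move=> p x; rewrite /update; case: eqP => [->|pi].
    split=> [[<-]|[Sx xQ]]; first by rewrite eqxx.
    case: eqP => [->//|/eqP xh xi].
    by have := full x Sx (notin _ xh xQ); rewrite xi ri.
  split=> [/(slotP inv)[Sx]|[Sx xQ]].
    by rewrite inE negb_or => /andP[/negPf-> xQ] xp.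
  by case: eqP => [_ /esym//|/eqP xh xp]; apply/(slotP inv); split=> //; apply: notin.
- apply/eqP; rewrite -eqSS -[_.+1]/(size (h :: Q)) (size_null inv) big_ltn // null_update //.
  by rewrite vN.
- move=> x Sx; rewrite /update; case: eqP => [e|_]; first by rewrite e Sh in Sx.
  exact: (pos_outside inv).
- move=> x Sx xQ; rewrite /update; case: eqP => [->|/eqP xh].
    by right; split=> //; [rewrite ri|exists i].
  exact: (pos_moved inv Sx (notin _ xh xQ)).
- move=> x y Sx Sy xy xQ yQ; rewrite /update.
  case: eqP => [ex|/eqP xh]; case: eqP => [ey|/eqP yh].
  + by have := order_queue inv Sx Sy xy; rewrite ex ey ltnn => /(_ hin hin).
  + have yQ' := notin _ yh yQ; rewrite ri lt_neqAle eq_sym.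
    rewrite (introF eqP (full _ Sy yQ')) /=.
    by apply: (order_queue_out inv Sx Sy xy) => //; rewrite ex.
  + by rewrite ri; apply: (order_out_queue inv Sx Sy xy); [exact: notin|rewrite ey].
  + by apply: (order_out inv Sx Sy xy); apply: notin.
- move=> x y Sx Sy xy xQ yQ; rewrite /update; case: eqP => [ey|/eqP yh].
    have := order_queue inv Sx Sy xy (inQ _ xQ).
    by rewrite ey /= eqxx ltn0 => /(_ hin).
  have yQ' := notin _ yh yQ; have := order_queue_out inv Sx Sy xy (inQ _ xQ) yQ'.
  by have := full y Sy yQ'; move: (rho (pos y)) => r; clear; lia.
- move=> x y Sx Sy xy xQ yQ; rewrite /update; case: eqP => [ex|/eqP xh].
    by rewrite ri ltz_nat.
  have := order_out_queue inv Sx Sy xy (notin _ xh xQ) (inQ _ yQ).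
  by move: (rho (pos x)) => r; clear; lia.
- move=> x y Sx Sy xy xQ yQ; have := order_queue inv Sx Sy xy (inQ _ xQ) (inQ _ yQ).
  by rewrite /= eq_sym noth // eq_sym noth.
Qed.

(** Without a hit there is no [R]-arc from the queue to [y], so [y] may stay in front of the
    queue. *)
Lemma inv_skip vtx pos Q i y : reorder_inv vtx pos Q i -> i < T ->
  vtx (sigma i) = Some y -> (forall u, u \in Q -> ~~ H u y) ->
  reorder_inv vtx pos Q i.+1.
Proof.
move=> inv iT vy nhit; have ri : rho (sigma i) = Posz i by rewrite rho_sigma // ltnW.
split; [exact: queue_uniq inv | | exact: slotP inv | | exact: pos_outside inv
       | exact: pos_moved inv | exact: order_out inv | | | exact: order_queue inv].
- move=> x xQ; have [Sx Px xQ0 x0] := queue_mem inv xQ; split=> //.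
  by apply: le_trans x0 _; rewrite lez_nat.
- by rewrite (size_null inv) big_ltn // vy add0n.
- move=> x z Sx Sz xz xQ zQ; have := order_queue_out inv Sx Sz xz xQ zQ.
  suff: rho (pos z) <> Posz i by move: (rho (pos z)) => r; clear; lia.
  rewrite -ri => /rho_inj zi.
  have /(slotP inv) : [/\ S z, z \notin Q & pos z = sigma i] by [].
  by rewrite vy => -[e]; have := nhit _ xQ; rewrite e (R_H Sx Sz xz).
- move=> x z Sx Sz xz xQ zQ; have := order_out_queue inv Sx Sz xz xQ zQ.
  by move: (rho (pos x)) => r; clear; lia.
Qed.

Lemma reorder_step vtx pos h Q i : reorder_inv vtx pos (h :: Q) i -> i < T ->
  exists vtx' pos' Q', [/\
    reorder_slot (hit (h :: Q) (vtx (sigma i))) vtx pos (h :: Q) (sigma i) = (vtx', pos', Q'),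
    reorder_inv vtx' pos' Q' i.+1,
    forall p, p != sigma i -> vtx' p = vtx p &
    vtx (sigma i) = None -> vtx' (sigma i) = Some h].
Proof.
move=> inv iT; rewrite /reorder_slot /hit; case e: (vtx (sigma i)) => [y|].
  case: ifP => [/hasP[u uQ uy]|/hasPn nhit].
    exists (update (update vtx (sigma i) None) (sigma i) (Some h)).
    exists (update pos h (sigma i)), (rcons Q y).
    have inv' := inv_enqueue inv iT e uQ uy.
    split=> //; first by rewrite /= {1}/update eqxx.
      by apply: inv_pop inv' iT _; rewrite /update eqxx.
    by move=> p /negPf pi; rewrite /update pi.
  exists vtx, pos, (h :: Q); rewrite e; split=> //.
  exact: inv_skip inv iT e nhit.
exists (update vtx (sigma i) (Some h)), (update pos h (sigma i)), Q.
rewrite e; split=> //; first exact: inv_pop.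
  by move=> p /negPf pi; rewrite /update pi.
by rewrite /update eqxx.
Qed.

(** By [size_null] the queue is exactly as long as the number of null slots ahead, so it is empty by
    the time the slots run out. Charging each test to those null slots counts slot [l] once for
    every visited slot up to [l], that is [(l - i).+1] times. *)
Lemma reorder_run N vtx pos Q i : T = i + N -> reorder_inv vtx pos Q i ->
  exists t vtx' pos' i', [/\ loop reorder_body (vtx, pos, Q, i) t (vtx', pos'),
    reorder_inv vtx' pos' [::] i',
    forall p, (rho p < Posz i)%R -> vtx' p = vtx p &
    t <= 1 + 2 * \sum_(i <= l < T) (~~ vtx (sigma l)) * (l - i).+1].
Proof.
elim: N vtx pos Q i => [|N IH] vtx pos [|h Q] i Ti inv.
- exists 1, vtx, pos, i; split=> //; exact: LoopStop.
- by have := size_null inv; rewrite Ti addn0 big_geq.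
- exists 1, vtx, pos, i; split=> //; exact: LoopStop.
have iT : i < T by rewrite Ti addnS ltnS leq_addr.
have [vtx1 [pos1 [Q1 [slot inv1 same _]]]] := reorder_step inv iT.
have [|t [vtx2 [pos2 [i' [run inv2 same2 time]]]]] := IH vtx1 pos1 Q1 i.+1 _ inv1.
  by rewrite Ti addnS.
have ri : rho (sigma i) = Posz i by rewrite rho_sigma // ltnW.
exists ((size Q).+2 + t), vtx2, pos2, i'; split=> //.
- by apply: LoopNext run; rewrite /= -/(hit _ _) slot.
- move=> p pi; rewrite same2 ?same //; first by apply/eqP => e; rewrite e ri ltxx in pi.
  by apply: lt_trans pi _; rewrite ltz_nat.
have -> : \sum_(i <= l < T) ~~ vtx (sigma l) * (l - i).+1 =
          size (h :: Q) + \sum_(i.+1 <= l < T) ~~ vtx1 (sigma l) * (l - i.+1).+1.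
  rewrite (size_null inv) !(big_ltn iT) subnn muln1 -addnA -big_split; congr (_ + _).
  apply: eq_big_nat => l /andP[il lT]; rewrite same.
    by case: (vtx (sigma l)) => [z|] /=; clear -il; lia.
  by apply/eqP => /(sigma_inj (ltnW lT) (ltnW iT)); clear -il; lia.
by clear -time => /=; lia.
Qed.

(** The first slot visited going forward is the null slot [k] and the queue starts with [w], so [w]
    ends up in slot [k]; this identifies the canonical vertex of a new component. *)
Lemma reorder_run_head N vtx pos h Q i : T = i + N.+1 -> reorder_inv vtx pos (h :: Q) i ->
  vtx (sigma i) = None ->
  forall t vtx' pos', loop reorder_body (vtx, pos, h :: Q, i) t (vtx', pos') ->
  vtx' (sigma i) = Some h.
Proof.
move=> Ti inv vN t vtx' pos' run.
have iT : i < T by rewrite Ti addnS ltnS leq_addr.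
have ri : rho (sigma i) = Posz i by rewrite rho_sigma // ltnW.
have [vtx1 [pos1 [Q1 [slot inv1 _ head]]]] := reorder_step inv iT.
have [|t2 [vtx2 [pos2 [i' [run2 _ same2 _]]]]] := reorder_run (N := N) _ inv1.
  by rewrite Ti addnS.
have : loop reorder_body (vtx, pos, h :: Q, i) ((size Q).+2 + t2) (vtx2, pos2).
  by apply: LoopNext run2; rewrite /= -/(hit _ _) slot.
move=> /(loop_det run)[_ [-> _]]; rewrite same2 ?head // ri ltz_nat //.
Qed.

End Reorder.

Lemma pairwise_index (T : eqType) (r : rel T) (s : seq T) x y :
  pairwise r s -> x \in s -> y \in s -> x != y -> ~~ r y x ->
  index x s < index y s.
Proof.
move=> rs xs ys xy yx; case: (ltngtP (index x s) (index y s)) => // [lt|e].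
  have /(pairwiseP x)/(_ (index y s) (index x s)) := rs.
  by rewrite !inE !index_mem !nth_index // (negPf yx) => /(_ ys xs lt).
by have := nth_index x xs; rewrite e nth_index // => yx'; rewrite yx' eqxx in xy.
Qed.

(** * The search from its starting state, and sums over the slots it empties *)

Section SearchReorder.
Variables (n : nat) (E : rel 'I_n) (s : state n) (v w : 'I_n).
Hypotheses (sV : valid E s) (Lv : live s v) (Lw : live s w).
Hypothesis wv : position s w < position s v.

Notation pos := (position s).
Notation m := #|live s|.
Let A := adj (set_arc s v w).

(** Positions increase along live arcs, so a path from [w] to [x] stays before the bound and
    [side_complete] applies to each of its arcs. *)
Lemma sideF_mem F a x : forward_side E s w F a -> live s x ->
  connect E w x -> pos x < a -> x \in F.
Proof.
move=> side Lx /(connect_live sV Lw Lx)/connectP[p].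
elim/last_ind: p x Lx => [|p y IH] x Lx /=.
  by move=> _ -> _; have [Q' ->] := side_root side; rewrite inE eqxx.
rewrite rcons_path last_rcons => /andP[wp zy] -> ya; have yL := live_arc_position sV zy.
have Lz : live s (last w p) by case/and3P: zy.
apply: (side_complete side _ zy ya); apply: IH => //; exact: ltn_trans yL ya.
Qed.

Lemma sideB_mem B b x : backward_side E s v B b -> live s x ->
  connect E x v -> b < pos x -> x \in B.
Proof.
move=> side Lx /(connect_live sV Lx Lv)/connectP[p].
elim: p x Lx => [|y p IH] x Lx /=.
  by move=> _ <- _; have [Q' ->] := side_root side; rewrite inE eqxx.
move=> /andP[xy yp] e bx; have xyL := live_arc_position sV xy.
have Ly : live s y by case/and3P: xy.
apply: (side_complete side (u := y) (x := x)) => //.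
apply: IH => //; exact: ltn_trans bx xyL.
Qed.

Lemma search_run : exists t vtx F B k (e : bool),
  [/\ loop (search_body A) (search_start (vertex s) pos v w) t (vtx, F, B, k),
      0 < k <= m /\ size F = size B + e,
      forward_side E s w F (k + e) /\ backward_side E s v B (k + e).-1,
      search_vertex s vtx F B /\ vtx k = None &
      t <= 2 * (thetaF s F (k + e) + thetaB s B (k + e).-1) + size F + 1].
Proof.
have v_gt0 : 0 < pos v by apply: leq_ltn_trans wv.
have vtxP : search_vertex s (update (update (vertex s) (pos w) None) (pos v) None) [:: w] [:: v].
  apply: (search_vertex_enqueue sV (F := [:: w]) (B := [::])) Lv _ => [|y]; last first.
    by rewrite !inE andbT andbC.
  apply: (search_vertex_enqueue sV (F := [::]) (B := [::])) Lw _ => [p y|y]; last first.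
    by rewrite !inE.
  by split=> [/(vertexP sV)[]|[Ly _ _ yp]] //; apply/(vertexP sV).
have sideF : forward_side E s w [:: w] ((pos w).+1 + 0).
  rewrite addn0; split=> //.
  - by exists [::].
  - by move=> x; rewrite inE => /eqP->; rewrite connect0 /= ltnSn.
  - move=> u x; rewrite inE => /eqP-> /(live_arc_position sV) wx.
    by rewrite /= ltnS leqNgt wx.
have sideB : backward_side E s v [:: v] (pos v + 0).-1.
  rewrite addn0; split=> //.
  - by exists [::].
  - by move=> x; rewrite inE => /eqP->; rewrite connect0 /= prednK.
  - move=> u x; rewrite inE => /eqP-> /(live_arc_position sV) xv /=.
    by rewrite prednK // leqNgt xv.
have vm : pos v <= m by case/andP: (position_range sV Lv).
have e : pos v = (pos w).+1 + (pos v - (pos w).+1) by rewrite subnKC.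
have [|t [vtx [F [B [k [e' [run kr sides vP time]]]]]]] :=
  search_loop (d := Forward) sV Lv Lw wv e isT vm (erefl : size [:: w] = size [:: v] + 0) sideF sideB vtxP.
  by rewrite /update eqxx.
exists t, vtx, F, B, k, e'; split=> //; move: time; rewrite -/A; clear; lia.
Qed.

Section Nulls.
Variables (vtx : nat -> option 'I_n) (F B : seq 'I_n).
Hypothesis vtxP : search_vertex s vtx F B.
Hypothesis FBu : uniq (F ++ B).
Hypothesis FBL : forall x, x \in F ++ B -> live s x.

Lemma null_count p : 0 < p <= m -> (~~ vtx p : nat) = \sum_(x <- F ++ B) (pos x == p).
Proof.
move=> /(slot_full sV)[x Lx xp].
have -> : \sum_(y <- F ++ B) (pos y == p) = \sum_(y <- F ++ B) (y == x).
  rewrite !big_seq; apply: eq_bigr => y /FBL Ly; congr nat_of_bool.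
  by apply/eqP/eqP => [yp|-> //]; apply: (position_inj sV Ly Lx); rewrite yp.
have -> : \sum_(y <- F ++ B) (y == x) = count_mem x (F ++ B).
  by rewrite -sum1_count [RHS]big_mkcond; apply: eq_bigr => y _ /=; case: eqP.
rewrite count_uniq_mem //.
case xFB: (x \in F ++ B).
  by rewrite -xp (search_null sV vtxP) //; apply/orP; rewrite -mem_cat.
have -> // : vtx p = Some x.
by apply/vtxP; split=> //; move/negbT: xFB; rewrite mem_cat negb_or => /andP[].
Qed.

(** The null slots are the old positions of the queued vertices. This turns the reordering time, a
    sum over slots, into distances from queued vertices to [k]. *)
Lemma null_sum (g : nat -> nat) a b : 0 < a -> b <= m.+1 ->
  \sum_(a <= p < b) (~~ vtx p) * g p =
  \sum_(x <- F ++ B | a <= pos x < b) g (pos x).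
Proof.
move=> a_gt0 bm.
under eq_big_nat => p /andP[ap pb].
  rewrite null_count; last by rewrite (leq_trans a_gt0 ap) -ltnS (leq_trans pb bm).
  rewrite big_distrl /=; over.
rewrite exchange_big [RHS]big_mkcond /=; apply: eq_bigr => x _.
case: ifP => [xab|/negbT xab].
  rewrite (bigD1_seq (pos x)) ?iota_uniq ?mem_index_iota //= eqxx mul1n.
  by rewrite big1 ?addn0 // => p /negPf px; rewrite eq_sym px.
rewrite big_nat big1 // => p pab; case: eqP => // e.
by rewrite e pab in xab.
Qed.

End Nulls.
End SearchReorder.

(** * The two phases of the reordering and their combined cost *)

Section Reordered.
Variables (n : nat) (E : rel 'I_n) (s : state n) (v w : 'I_n).
Hypotheses (sV : valid E s) (Lv : live s v) (Lw : live s w).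
Hypothesis wv : position s w < position s v.

Notation pos := (position s).
Notation m := #|live s|.
Let A := adj (set_arc s v w).

Definition search_cost (F B : seq 'I_n) (k : nat) :=
  \sum_(u <- F) (k - pos u) + \sum_(z <- B) (pos z - k).

(* The arcs exempted in [re_order] have both ends in the new component. *)
Record reordered (vtx' : nat -> option 'I_n) (pos' : 'I_n -> nat)
    (F B : seq 'I_n) (k : nat) : Prop := Reordered {
  re_vertex : forall p x, vtx' p = Some x <-> live s x /\ pos' x = p;
  re_range : forall x, live s x -> 0 < pos' x <= m;
  re_root : pos' w = k;
  re_moved : forall x, live s x ->
    [\/ pos' x = pos x,
        [/\ connect E w x, k <= pos' x & pos x <= pos' x]
      | [/\ connect E x v, pos' x < k & pos' x <= pos x]];
  re_uniq : uniq (F ++ B);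
  re_front : forall u, u \in F ->
    [/\ live s u, connect E w u & pos u <= k <= pos' u];
  re_back : forall z, z \in B ->
    [/\ live s z, connect E z v & pos' z < k <= pos z];
  re_front_back : forall u z, u \in F -> z \in B -> pos u < pos z;
  re_w : w \in F;
  re_v : v \in B;
  re_between : forall x, live s x -> connect E w x -> connect E x v ->
    x \in F ++ B;
  re_order : forall x y, live s x -> live s y -> A x y ->
    ~~ (connect E w x && connect E y v) -> pos' x < pos' y;
  re_size : size B <= size F <= (size B).+1 }.

Lemma adjA_position x y : live s x -> live s y -> A x y ->
  x = v /\ y = w \/ pos x < pos y.
Proof.
move=> Lx Ly; rewrite /A /= => /orP[/andP[/eqP-> /eqP->]|xy]; first by left.
by right; apply: (position_topological sV Lx Ly).
Qed.

Lemma adjA_reach x y : live s x -> live s y -> A x y ->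
  connect E w x -> connect E w y.
Proof.
move=> Lx Ly; rewrite /A /= => /orP[/andP[_ /eqP->]|xy]; first by rewrite connect0.
by move/connect_trans; apply; apply: (adj_connect sV Lx Ly xy).
Qed.

Lemma adjA_coreach x y : live s x -> live s y -> A x y ->
  connect E y v -> connect E x v.
Proof.
move=> Lx Ly; rewrite /A /= => /orP[/andP[/eqP-> _]|xy]; first by rewrite connect0.
by apply: connect_trans; apply: (adj_connect sV Lx Ly xy).
Qed.

Section Phases.
Variables (vtx1 : nat -> option 'I_n) (F B : seq 'I_n) (k : nat) (e : bool).
Hypothesis k_range : 0 < k <= m.
Hypothesis szFB : size F = size B + e.
Hypothesis sideF : forward_side E s w F (k + e).
Hypothesis sideB : backward_side E s v B (k + e).-1.
Hypothesis vtxP : search_vertex s vtx1 F B.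
Hypothesis vtxk : vtx1 k = None.

Lemma mem_front u : u \in F -> [/\ live s u, connect E w u & pos u <= k].
Proof.
move=> /(side_mem sideF)[-> ->] uk; split=> //.
by move: uk; case: (e); rewrite ?addn1 ?addn0 ?ltnS // => /ltnW.
Qed.

Lemma mem_back z : z \in B -> [/\ live s z, connect E z v & k <= pos z].
Proof.
move=> /(side_mem sideB)[-> ->] /= zk; split=> //.
by move: zk; move: k_range => /andP[k0 _]; case: (e); rewrite ?addn1 ?addn0 ?prednK // => /ltnW.
Qed.

Lemma front_back u z : u \in F -> z \in B -> pos u < pos z.
Proof.
move=> /(side_mem sideF)[_ _ uk] /(side_mem sideB)[_ _ /= zk].
by move: uk zk k_range; clear; lia.
Qed.

Lemma front_notin_back u : u \in F -> u \notin B.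
Proof. by move=> uF; apply/negP => /(front_back uF); rewrite ltnn. Qed.

Lemma front_back_uniq : uniq (F ++ B).
Proof.
rewrite cat_uniq (side_uniq sideF) (side_uniq sideB) andbT.
by apply/hasPn => z zB; apply/negP => /front_notin_back; rewrite zB.
Qed.

Lemma front_back_live x : x \in F ++ B -> live s x.
Proof. by rewrite mem_cat => /orP[/mem_front[]|/mem_back[]]. Qed.

Lemma w_front : w \in F.
Proof. by have [Q ->] := side_root sideF; rewrite inE eqxx. Qed.

Lemma v_back : v \in B.
Proof. by have [Q ->] := side_root sideB; rewrite inE eqxx. Qed.

Lemma slot_k x : live s x -> pos x = k -> x \in F \/ x \in B.
Proof.
move=> Lx xk; apply/orP; apply: contraT; rewrite negb_or => /andP[xF xB].
by have : vtx1 k = Some x; [apply/vtxP|rewrite vtxk].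
Qed.

Lemma between_mem x : live s x -> connect E w x -> connect E x v -> x \in F ++ B.
Proof.
move=> Lx wx xv; rewrite mem_cat; apply/orP.
case: (ltngtP (pos x) k) => [xk|kx|/(slot_k Lx)//].
  by left; apply: (sideF_mem sV Lw sideF) => //; apply: leq_trans xk (leq_addr _ _).
right; apply: (sideB_mem sV Lv sideB) => //.
by move: kx k_range; clear; case: e; lia.
Qed.

(** Vertices of [B] are absent from the array throughout the forward phase, so they are left out of
    the order that it builds. *)
Let SF : pred 'I_n := fun x => live s x && (x \notin B).
Let RF : rel 'I_n := fun x y => A x y && ~~ (connect E w x && connect E y v).
Let rhoF p : int := (Posz p - Posz k)%R.
Let TF := m.+1 - k.

Lemma invF : reorder_inv SF (connect E w) RF rhoF (addn k) TF pos F vtx1 pos F 0.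
Proof.
have [k_gt0 km] := andP k_range.
have arc x y : SF x -> SF y -> RF x y -> live_arc s x y.
  move=> /andP[Lx xB] /andP[Ly yB] /andP[+ _]; rewrite /A /live_arc /= Lx Ly /=.
  by case/orP=> // /andP[/eqP xv _]; rewrite xv v_back in xB.
split=> //.
- exact: side_uniq sideF.
- move=> x xF; have [Lx wx xk] := mem_front xF.
  split=> //; [by rewrite /SF Lx front_notin_back|by left|].
  by rewrite /rhoF; clear -xk; lia.
- move=> p x; rewrite /SF; split=> [/vtxP[-> -> -> ->]//|[/andP[Lx xB] xF xp]].
  exact/vtxP.
(* The null slots from [k] on are those vacated by [B], and slot [k] itself when a vertex of [F]
   vacated it, which happens exactly when [e] holds. Their number is [size B + e = size F]. *)
- have -> : \sum_(0 <= l < TF) ~~ vtx1 (k + l) = \sum_(k <= p < m.+1) (~~ vtx1 p) * 1.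
    rewrite -{2}[k]add0n big_addn; apply: eq_bigr => l _; by rewrite muln1 addnC.
  rewrite (null_sum sV vtxP front_back_uniq front_back_live) // sum1_count count_cat.
  have -> : count (fun x => k <= pos x < m.+1) B = size B.
    rewrite -size_filter (all_filterP _) //; apply/allP => z /mem_back[Lz _ ->].
    by have /andP[_] := position_range sV Lz; rewrite ltnS.
  have -> : count (fun x => k <= pos x < m.+1) F = e; last by rewrite szFB addnC.
  have [x Lx xk] := slot_full sV k_range.
  have -> : count (fun x => k <= pos x < m.+1) F = count_mem x F.
    apply: eq_in_count => u /mem_front[Lu _ uk].
    apply/andP/eqP => [[ku _]|->]; last by rewrite xk ltnS km leqnn.
    by apply: (position_inj sV Lu Lx); rewrite xk; apply/eqP; rewrite eqn_leq uk ku.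
  rewrite count_uniq_mem ?(side_uniq sideF) //; congr nat_of_bool.
  case: (slot_k Lx xk) => [xF|xB].
    rewrite xF; have [_ _] := side_mem sideF xF; rewrite xk /=.
    by case: (e) => //; rewrite addn0 ltnn.
  have [_ _] := side_mem sideB xB; rewrite xk /=.
  have -> : (x \in F) = false by apply/negP => /front_notin_back; rewrite xB.
  by case: (e) => //; rewrite addn1 ltnn.
- by move=> x _ xF; left.
- move=> x y Sx Sy xy _ _; have := live_arc_position sV (arc _ _ Sx Sy xy).
  by rewrite /rhoF; clear; lia.
- move=> x y Sx Sy xy xF yF; have a := arc _ _ Sx Sy xy.
  suff: k <= pos y by rewrite /rhoF; clear; lia.
  rewrite leqNgt; apply/negP => yk; move/negP: yF; apply.
  by apply: (side_complete sideF xF a); apply: leq_trans yk (leq_addr _ _).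
- move=> x y Sx Sy xy xF /mem_front[_ _ yk].
  have := live_arc_position sV (arc _ _ Sx Sy xy).
  by rewrite /rhoF; move: yk; clear; lia.
- move=> x y Sx Sy xy xF yF; have lt := live_arc_position sV (arc _ _ Sx Sy xy).
  apply: (pairwise_index (side_sorted sideF)) => //=.
    by apply: contraTneq lt => ->; rewrite ltnn.
  by rewrite -leqNgt ltnW.
Qed.

Lemma phaseF : exists t vtx2 pos2 i,
  [/\ loop (reorderF_body A) (vtx1, pos, F, k) t (vtx2, pos2),
      reorder_inv SF (connect E w) RF rhoF (addn k) TF pos F vtx2 pos2 [::] i,
      vtx2 k = Some w,
      forall p, p < k -> vtx2 p = vtx1 p &
      t <= 1 + 2 * (size F + size B + \sum_(z <- B) (pos z - k))].
Proof.
have [k_gt0 km] := andP k_range.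
have rinj : injective rhoF by move=> p q; rewrite /rhoF; clear; lia.
have rs i : i <= TF -> rhoF (k + i) = Posz i by rewrite /rhoF => _; clear; lia.
have RH x y : SF x -> SF y -> RF x y -> A x y by move=> _ _ /andP[].
have HP x y : SF x -> SF y -> connect E w x -> A x y -> connect E w y.
  by move=> /andP[Lx _] /andP[Ly _] wx xy; apply: adjA_reach xy wx.
have [t [vtx2 [pos2 [i [run inv same time]]]]] :=
  reorder_run rinj rs RH HP (erefl : TF = 0 + TF) invF.
have run' : loop (reorderF_body A) (vtx1, pos, F, k) t (vtx2, pos2).
  rewrite -[k]addn0.
  apply: (loop_simulation (g := fun st : reorder_state n => (st.1, k + st.2))) run => -[[[vtx p] Q] l] /=.
  by case: (nilp Q) => /=; rewrite ?addnS.
exists t, vtx2, pos2, i; split=> //.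
- have [Q eF] := side_root sideF.
  have TFE : TF = 0 + (m - k).+1 by rewrite add0n -subSn.
  have inv0 := invF; have run0 := run; rewrite eF in run0.
  have {}inv0 : reorder_inv SF (connect E w) RF rhoF (addn k) TF pos F vtx1 pos (w :: Q) 0.
    by rewrite -eF.
  have vtxk0 : vtx1 (k + 0) = None by rewrite addn0.
  by have := reorder_run_head rinj rs RH HP TFE inv0 vtxk0 run0; rewrite addn0.
- by move=> p pk; apply: same; rewrite /rhoF; clear -pk; lia.
apply: leq_trans time _; rewrite leq_add2l leq_mul2l /=.
have -> : \sum_(0 <= l < TF) ~~ vtx1 (k + l) * (l - 0).+1 =
          \sum_(k <= p < m.+1) ~~ vtx1 p * (p - k).+1.
  rewrite -{2}[k]add0n big_addn; apply: eq_bigr => l _.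
  by rewrite subn0 addnK addnC.
rewrite (null_sum sV vtxP front_back_uniq front_back_live (fun p => (p - k).+1)) //.
rewrite big_cat -addnA /=; apply: leq_add.
  rewrite big_mkcond /= -[size F]sum1_size !big_seq; apply: leq_sum => u /mem_front[_ _ uk].
  by case: ifP => // _; move: uk; clear; lia.
rewrite big_mkcond /= -[size B]sum1_size -big_split /=.
by apply: leq_sum => z _; case: ifP => _; clear; lia.
Qed.

(** The backward phase is the abstract loop with arcs reversed and slots counted down from
    [k - 1]. *)
Let RB : rel 'I_n := fun y x => A x y && ~~ (connect E w x && connect E y v).
Let rhoB p : int := (Posz k - 1 - Posz p)%R.
Let sigmaB i := (k - i).-1.

Section PhaseB.
Variables (vtx2 : nat -> option 'I_n) (pos2 : 'I_n -> nat) (i : nat).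
Hypothesis inv2 : reorder_inv SF (connect E w) RF rhoF (addn k) TF pos F vtx2 pos2 [::] i.
Hypothesis vtx2k : vtx2 k = Some w.
Hypothesis same2 : forall p, p < k -> vtx2 p = vtx1 p.

Lemma moved2 x : live s x -> x \notin B ->
  pos2 x = pos x /\ x \notin F \/
  [/\ connect E w x, pos x <= pos2 x & k <= pos2 x <= m].
Proof.
move=> Lx xB; have Sx : SF x by rewrite /SF Lx.
case: (pos_moved inv2 Sx (negbT (in_nil x))) => [|[wx _ le [l lT xl]]]; first by left.
have [k_gt0 km] := andP k_range.
right; split=> //; first by move: le; rewrite /rhoF; clear; lia.
by move: lT km; rewrite xl /TF; clear; lia.
Qed.

Lemma pos2_back x : x \in B -> pos2 x = pos x.
Proof. by move=> xB; apply: (pos_outside inv2); rewrite /SF xB andbF. Qed.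

Lemma invB : reorder_inv (live s) (fun x => connect E x v) RB rhoB sigmaB k.-1
  pos2 B vtx2 pos2 B 0.
Proof.
have [k_gt0 km] := andP k_range.
have arc x y : x \notin B \/ y \in B -> live s x -> live s y -> A x y -> pos x < pos y.
  move=> xyB Lx Ly /(adjA_position Lx Ly)[[ex ey]|//].
  by case: xyB; [rewrite ex v_back|rewrite ey (negPf (front_notin_back w_front))].
split=> //.
- exact: side_uniq sideB.
- move=> x xB; have [Lx xv kx] := mem_back xB.
  split=> //; first by left.
  by rewrite /rhoB pos2_back //; clear -kx; lia.
- move=> p x; split=> [/(slotP inv2)[/andP[Lx xB] _ xp]//|[Lx xB xp]].
  by apply/(slotP inv2); split=> //; rewrite /SF Lx.
(* The forward phase left the slots below [k] alone, so the null ones are those vacated by [F], slot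
   [k] excluded: [size F - e = size B] of them. *)
- have -> : \sum_(0 <= l < k.-1) ~~ vtx2 (sigmaB l) = \sum_(1 <= p < k) (~~ vtx1 p) * 1.
    rewrite [RHS]big_nat_rev big_add1; apply: eq_big_nat => l /andP[_ lk].
    have e1 : 1 + k - l.+2 = sigmaB l by rewrite /sigmaB; clear; lia.
    by rewrite e1 muln1 same2 // /sigmaB; clear -lk; lia.
  rewrite (null_sum sV vtxP front_back_uniq front_back_live _ (ltn0Sn 0) (leqW km)).
  rewrite sum1_count count_cat.
  have -> : count (fun x => 0 < pos x < k) B = 0.
    apply/eqP; rewrite -leqn0 leqNgt -has_count; apply/hasPn => z /mem_back[_ _].
    by rewrite leqNgt => /negPf->; rewrite andbF.
  rewrite addn0; have [x Lx xk] := slot_full sV k_range.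
  have := count_predC (fun x => 0 < pos x < k) F; rewrite szFB.
  have -> : count (predC (fun x => 0 < pos x < k)) F = count_mem x F.
    apply: eq_in_count => u /mem_front[Lu _ uk] /=.
    have /andP[-> _] /= := position_range sV Lu; rewrite -leqNgt.
    apply/idP/eqP => [ku|->]; last by rewrite xk.
    by apply: (position_inj sV Lu Lx); rewrite xk; apply/eqP; rewrite eqn_leq uk ku.
  rewrite count_uniq_mem ?(side_uniq sideF) //.
  have -> : (x \in F) = e; last by clear; lia.
  case: (slot_k Lx xk) => [xF|xB].
    rewrite xF; have [_ _] := side_mem sideF xF; rewrite xk /=.
    by case: (e) => //; rewrite addn0 ltnn.
  have [_ _] := side_mem sideB xB; rewrite xk /=.
  have -> : (x \in F) = false by apply/negP => /front_notin_back; rewrite xB.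
  by case: (e) => //; rewrite addn1 ltnn.
- by move=> x _ xB; left.
- move=> y x Ly Lx /andP[xy mid] yB xB.
  have := order_out inv2 (x := x) (y := y); rewrite /SF Lx Ly xB yB /RF xy mid.
  by move=> /(_ isT isT isT isT isT); rewrite /rhoF /rhoB; clear; lia.
- move=> z x Lz Lx /andP[xz mid] zB xB.
  (* As [z] reaches [v], the exemption does not apply only if [w] does not reach [x]; hence [x] did
     not move forward. At or after slot [k], it would have been found by the backward search. *)
  suff: pos2 x < k by rewrite /rhoB; clear; lia.
  have [_ zv _] := mem_back zB.
  case: (moved2 Lx xB) => [[-> xF]|[wx _ _]]; last by rewrite wx zv in mid.
  rewrite ltnNge; apply/negP => kx; have lt := arc _ _ (or_introl xB) Lx Lz xz.
  have [xk|kltx] : pos x = k \/ k < pos x by move: kx; clear; lia.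
    by case: (slot_k Lx xk) => h; [rewrite h in xF|rewrite h in xB].
  move/negP: xB; apply.
  apply: (sideB_mem sV Lv sideB) => //; first exact: adjA_coreach xz zv.
  by move: kltx k_range; clear; case: e; lia.
- move=> y z Ly Lz /andP[zy mid] yB zB.
  suff: k <= pos2 y by rewrite /rhoB; clear; lia.
  have [_ zv kz] := mem_back zB.
  case: (moved2 Ly yB) => [[-> yF]|[_ _ /andP[]//]].
  case: (adjA_position Lz Ly zy) => [[_ ew]|]; first by rewrite ew w_front in yF.
  by move=> /ltnW; apply: leq_trans.
- move=> y x Ly Lx /andP[xy mid] yB xB; have lt := arc _ _ (or_intror yB) Lx Ly xy.
  apply: (pairwise_index (side_sorted sideB)) => //=.
    by apply: contraTneq lt => ->; rewrite ltnn.
  by rewrite -leqNgt ltnW.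
Qed.

Lemma phaseB : exists t vtx3 pos3,
  [/\ loop (reorderB_body A) (vtx2, pos2, B, k) t (vtx3, pos3),
      reordered vtx3 pos3 F B k &
      t <= 1 + 2 * \sum_(u <- F) (k - pos u)].
Proof.
have [k_gt0 km] := andP k_range.
have rinj : injective rhoB by move=> p q; rewrite /rhoB; clear; lia.
have rs l : l <= k.-1 -> rhoB (sigmaB l) = Posz l.
  by rewrite /rhoB /sigmaB => lk; clear -lk k_gt0; lia.
have RH y x : live s y -> live s x -> RB y x -> A x y by move=> _ _ /andP[].
have HP y x : live s y -> live s x -> connect E y v -> A x y -> connect E x v.
  by move=> Ly Lx yv xy; apply: adjA_coreach xy yv.
have [t [vtx3 [pos3 [i' [run inv same time]]]]] :=
  reorder_run (H := fun y x => A x y) rinj rs RH HP (erefl : k.-1 = 0 + k.-1) invB.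
exists t, vtx3, pos3; split.
- rewrite -[k]subn0.
  apply: (loop_simulation (g := fun st : reorder_state n => (st.1, k - st.2))) run => -[[[vtx p] Q] l] /=.
  by case: (nilp Q) => /=; rewrite ?subnS.
- have moved3 x : live s x -> pos3 x = pos2 x /\ x \notin B \/
      [/\ connect E x v, x \in B \/ pos2 x < k, pos3 x <= pos2 x & 0 < pos3 x < k].
    move=> Lx; case: (pos_moved inv Lx (negbT (in_nil x))) => [|[xv xB le [l lk xl]]]; first by left.
    right; split=> //.
    + by case: xB => [->|x0]; [left|right; move: x0; rewrite /rhoB; clear; lia].
    + by move: le; rewrite /rhoB; clear; lia.
    + by rewrite xl /sigmaB; clear -lk; lia.
  have kw : pos2 w = k by case/(slotP inv2): vtx2k.
  have vtx3k : vtx3 k = Some w by rewrite same // /rhoB; clear; lia.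
  have frontE u : u \in F -> pos3 u = pos2 u /\ k <= pos2 u.
    move=> uF; have [Lu _ _] := mem_front uF; have uB := front_notin_back uF.
    have ku : k <= pos2 u.
      by case: (moved2 Lu uB) => [[_]|[_ _ /andP[]//]]; rewrite uF.
    case: (moved3 u Lu) => [[-> _]//|[_ [h|h] _ _]]; first by rewrite h in uB.
    by move: ku; rewrite leqNgt h.
  have backE z : z \in B -> pos3 z < k.
    move=> zB; have [Lz _ _] := mem_back zB.
    by case: (moved3 z Lz) => [[_]|[_ _ _ /andP[]//]]; rewrite zB.
  split.
  + move=> p x; split=> [/(slotP inv)[Lx _ xp]//|[Lx xp]].
    exact/(slotP inv).
  + move=> x Lx; have /andP[x0 xm] := position_range sV Lx.
    case: (moved3 x Lx) => [[-> xB]|[_ _ _ /andP[-> xk]]]; last exact: leq_trans (ltnW xk) km.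
    case: (moved2 Lx xB) => [[-> _]|[_ _ /andP[kx ->]]]; first by rewrite x0 xm.
    by rewrite (leq_trans k_gt0 kx).
  + by case/(slotP inv): vtx3k.
  + move=> x Lx; case: (moved3 x Lx) => [[-> xB]|[xv xB le /andP[_ lt]]].
      by case: (moved2 Lx xB) => [[-> _]|[wx le /andP[kx _]]]; [apply: Or31|apply: Or32].
    apply: Or33; split=> //; case xB': (x \in B); first by rewrite -(pos2_back xB').
    case: xB => [|lt2]; first by rewrite xB'.
    case: (moved2 Lx (negbT xB')) => [[<- _]//|[_ _ /andP[]]].
    by rewrite leqNgt lt2.
  + exact: front_back_uniq.
  + move=> u uF; have [Lu wu uk] := mem_front uF; have [-> ku] := frontE u uF.
    by rewrite uk ku.
  + by move=> z zB; have [Lz zv kz] := mem_back zB; rewrite (backE z zB) kz.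
  + exact: front_back.
  + exact: w_front.
  + exact: v_back.
  + exact: between_mem.
  + move=> x y Lx Ly xy mid; have := order_out inv (x := y) (y := x) Ly Lx.
    by rewrite /RB xy mid => /(_ isT isT isT); rewrite /rhoB; clear; lia.
  + by rewrite szFB; case: (e); rewrite ?addn0 ?addn1 leqnn leqnSn.
apply: leq_trans time _; rewrite leq_add2l leq_mul2l /=.
have -> : \sum_(0 <= l < k.-1) ~~ vtx2 (sigmaB l) * (l - 0).+1 =
          \sum_(1 <= p < k) (~~ vtx1 p) * (k - p).
  rewrite [RHS]big_nat_rev big_add1; apply: eq_big_nat => l /andP[_ lk].
  have e1 : 1 + k - l.+2 = sigmaB l by rewrite /sigmaB; clear; lia.
  rewrite e1 same2; last by rewrite /sigmaB; clear -lk; lia.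
  by congr (_ * _); rewrite /sigmaB; clear -lk; lia.
rewrite (null_sum sV vtxP front_back_uniq front_back_live (subn k) (ltn0Sn 0) (leqW km)).
rewrite big_cat /= [X in _ + X]big1_seq ?addn0; last first.
  by move=> z /andP[/andP[_ zk]] /mem_back[_ _]; rewrite leqNgt zk.
by rewrite big_mkcond /=; apply: leq_sum => u _; case: ifP.
Qed.

End PhaseB.
End Phases.

Lemma search_and_reorder_run scc : exists t vtx' pos' F B k,
  [/\ search_and_reorder scc (set_arc s v w) v w t
        (vtx', pos', new_component scc (F ++ B) A, k),
      reordered vtx' pos' F B k &
      t <= 4 * search_cost F B k + 5 * (size F + size B) + 3 +
           new_component_time scc (F ++ B) A].
Proof.
have [t1 [vtx1 [F [B [k [e [run1 [kr szFB] [sideF sideB] [vtxP vtxk] time1]]]]]]] :=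
  search_run sV Lv Lw wv.
have [t2 [vtx2 [pos2 [i [run2 inv2 vtx2k same2 time2]]]]] :=
  phaseF kr szFB sideF sideB vtxP vtxk.
have [t3 [vtx3 [pos3 [run3 re time3]]]] :=
  phaseB kr szFB sideF sideB vtxP vtxk inv2 vtx2k same2.
exists (t1 + new_component_time scc (F ++ B) A + t2 + t3), vtx3, pos3, F, B, k.
split=> //; first exact: SearchAndReorder run1 run2 run3.
(* The final bounds of the two sides differ from [k] by at most one, at a cost of at most one per
   queued vertex. *)
have tF : thetaF s F (k + e) <= \sum_(u <- F) (k - pos u) + size F.
  rewrite /thetaF -sum1_size -big_split /=; apply: leq_sum => u _.
  by case: (e); clear; lia.
have tB : thetaB s B (k + e).-1 <= \sum_(z <- B) (pos z - k) + size B.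
  rewrite /thetaB -sum1_size -big_split /=; apply: leq_sum => u _.
  by case: (e); clear; lia.
move: time1 time2 time3 tF tB; rewrite /search_cost; clear; lia.
Qed.

End Reordered.

Lemma num_arcs_bound (V : finType) (S : seq V) (E : rel V) :
  num_arcs S E <= size S ^ 2.
Proof.
apply: (@leq_trans #|setX [set x in S] [set x in S]|).
  by apply/subset_leq_card/subsetP => -[x y]; rewrite !inE /= => /and3P[-> ->].
by rewrite cardsX cardsE -mulnn leq_mul // card_size.
Qed.

Lemma flatten_block_inj (T : eqType) (ss : seq (seq T)) D1 D2 x :
  uniq (flatten ss) -> D1 \in ss -> D2 \in ss -> x \in D1 -> x \in D2 -> D1 = D2.
Proof.
elim: ss => //= D ss IH; rewrite cat_uniq => /and3P[_ /hasPn disj u].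
have out D' : D' \in ss -> x \in D' -> x \notin D.
  by move=> D'ss xD'; apply: disj; apply/flattenP; exists D'.
rewrite !inE => /predU1P[->|D1ss] /predU1P[->|D2ss] // x1 x2.
- by have := out _ D2ss x2; rewrite x1.
- by have := out _ D1ss x1; rewrite x2.
- exact: IH.
Qed.

Lemma uniq_block (T : eqType) (ss : seq (seq T)) D : uniq (flatten ss) -> D \in ss -> uniq D.
Proof.
elim: ss => //= D' ss IH; rewrite cat_uniq inE => /and3P[u _ us] /predU1P[->//|].
exact: IH.
Qed.

(** * The new component *)

Section Component.
Variables (n : nat) (E : rel 'I_n) (s : state n) (v w : 'I_n).
Hypotheses (sV : valid E s) (Lv : live s v) (Lw : live s w).
Hypothesis wv : position s w < position s v.
Let A := adj (set_arc s v w).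
Variables (vtx' : nat -> option 'I_n) (pos' : 'I_n -> nat) (F B : seq 'I_n) (k : nat).
Hypothesis re : reordered E s v w vtx' pos' F B k.
Let S := F ++ B.

Definition between : pred 'I_n :=
  fun x => [&& live s x, connect E w x & connect E x v].

Lemma between_S x : between x -> x \in S.
Proof. by case/and3P; apply: (re_between re). Qed.

Lemma S_live x : x \in S -> live s x.
Proof. by rewrite mem_cat => /orP[/(re_front re)[]|/(re_back re)[]]. Qed.

Lemma vw_neq : v != w.
Proof. by apply: contraTneq wv => ->; rewrite ltnn. Qed.

Lemma induced_live_arc x y : x \in S -> y \in S -> live_arc s x y -> induced S A x y.
Proof. by move=> xS yS /and3P[_ _ xy]; rewrite /induced /A /= xS yS xy orbT. Qed.

(** Every vertex on a path from [w] to a vertex reaching [v] is itself [between], hence lies in [S]: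
    the path survives in the induced graph. *)
Lemma connect_to_between x : between x -> connect (induced S A) w x.
Proof.
case/and3P=> Lx /(connect_live sV Lw Lx)/connectP[p].
elim/last_ind: p x Lx => [|p y IH] x Lx /=; first by move=> _ ->.
rewrite rcons_path last_rcons => /andP[wp zy] -> yv; set z := last w p in zy.
have Lz : live s z by case/and3P: zy.
have Ly : live s y by case/and3P: zy.
have zyE := live_arc_connect sV zy; have zv := connect_trans zyE yv.
have wz : connect E w z.
  apply: (@sub_connect _ (live_arc s)); first exact: live_arc_connect.
  by apply/connectP; exists p.
apply: connect_trans (IH z Lz wp erefl zv) (connect1 _).
apply: induced_live_arc zy; apply: between_S; apply/and3P; split=> //.
exact: connect_trans zyE.
Qed.

Lemma connect_from_between x : between x -> connect (induced S A) x v.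
Proof.
case/and3P=> Lx wx /(connect_live sV Lx Lv)/connectP[p].
elim: p x Lx wx => [|y p IH] x Lx wx /=; first by move=> _ ->.
move=> /andP[xy yp] e; have Ly : live s y by case/and3P: xy.
have xyE := live_arc_connect sV xy; have wy := connect_trans wx xyE.
have yv : connect E y v.
  apply: (@sub_connect _ (live_arc s)); first exact: live_arc_connect.
  by apply/connectP; exists p.
apply: connect_trans (connect1 _) (IH y Ly wy yp e).
apply: induced_live_arc xy; apply: between_S; apply/and3P; split=> //.
exact: connect_trans yv.
Qed.

Lemma between_strong x y : between x -> between y -> strongly_connected S A x y.
Proof.
have vwS : connect (induced S A) v w.
  apply: connect1; rewrite /induced /A /= !eqxx !mem_cat (re_v re) (re_w re).
  by rewrite orbT.
move=> bx by'; apply/andP; split; apply: connect_trans (connect_from_between _) _ => //;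
  by apply: connect_trans vwS _; apply: connect_to_between.
Qed.

(** Distinct live vertices are not mutually reachable through old arcs, so at least one of the two
    paths uses the new arc. *)
Lemma strong_between x y : x \in S -> y \in S -> x != y ->
  strongly_connected S A x y -> between x.
Proof.
move=> xS yS xy /andP[cxy cyx].
have sub a b : induced S A a b -> connect (add_rel E v w) a b.
  case/and3P=> /S_live La /S_live Lb /orP[/andP[/eqP-> /eqP->]|ab].
    exact: connect_new_arc.
  by apply: connect_rel_add; apply: (adj_connect sV La Lb ab).
have Lx := S_live xS; have Ly := S_live yS.
have := connect_add_rel (sub_connect sub cxy).
have := connect_add_rel (sub_connect sub cyx).
move=> [yx|[yv wx]] [xy'|[xv wy]].
- by rewrite (mutual_live sV Lx Ly xy' yx) eqxx in xy.
- by apply/and3P; split=> //; apply: connect_trans wy yx.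
- by apply/and3P; split=> //; apply: connect_trans xy' yv.
- by apply/and3P.
Qed.

Variables (c : nat) (scc : seq 'I_n -> rel 'I_n -> seq (seq 'I_n) * nat).
Hypothesis sccP : linear_time_scc c scc.

Lemma scc_spec : [/\ uniq (flatten (scc S A).1), (flatten (scc S A).1) =i S &
  forall x y, x \in S -> y \in S -> strongly_connected S A x y ->
    exists D, [/\ D \in (scc S A).1, x \in D & y \in D]] /\
  forall x y D, D \in (scc S A).1 -> x \in D -> y \in D -> strongly_connected S A x y.
Proof.
have [perm _ blk _] := sccP A (re_uniq re); rewrite -/S in perm blk.
have mem := perm_mem perm.
split; first split=> //.
- by rewrite (perm_uniq perm) (re_uniq re).
- by move=> x y xS yS; rewrite -blk // => /hasP[D Dss /andP[xD yD]]; exists D.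
move=> x y D Dss xD yD.
by rewrite -blk -?mem; [apply/hasP; exists D; rewrite ?xD|apply/flattenP; exists D..].
Qed.

Lemma no_component : new_component scc S A = None -> ~~ connect E w v.
Proof.
have [[u mem ex] _] := scc_spec.
move=> none; apply/negP => wv'.
have bv : between v by rewrite /between Lv wv' connect0.
have bw : between w by rewrite /between Lw wv' connect0.
have [D [Dss vD wD]] := ex _ _ (between_S bv) (between_S bw) (between_strong bv bw).
have D2 : 1 < size D.
  have : size [:: v; w] <= size D.
    apply: uniq_leq_size; first by rewrite /= inE vw_neq.
    by move=> x; rewrite !inE => /orP[]/eqP->.
  by [].
have : D \in [seq D <- (scc S A).1 | 1 < size D] by rewrite mem_filter D2.
by move: none; rewrite /new_component; case: filter.
Qed.

(** A block with two elements consists of [between] vertices, and these all share one block; hence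
    the choice made by [ohead] is immaterial. *)
Lemma some_component D : new_component scc S A = Some D ->
  [/\ connect E w v, uniq D, 1 < size D & forall x, (x \in D) = between x].
Proof.
have [[u mem ex] blk] := scc_spec.
move=> some; have : D \in [seq D <- (scc S A).1 | 1 < size D].
  by move: some; rewrite /new_component; case: filter => //= D' ss [->]; rewrite inE eqxx.
rewrite mem_filter => /andP[D2 Dss]; have uD := uniq_block u Dss.
have DS x : x \in D -> x \in S by move=> xD; rewrite -mem; apply/flattenP; exists D.
have other x : x \in D -> exists2 y, y \in D & x != y.
  case: (D) D2 uD => // a [|b D'] // _ /andP[ab _] _.
  case: (eqVneq x a) => [->|xa]; last by exists a; rewrite ?inE ?eqxx.
  by exists b; [rewrite !inE eqxx orbT|apply: contraNneq ab => ->; rewrite inE eqxx].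
have Db x : x \in D -> between x.
  move=> xD; have [y yD xy] := other x xD.
  by apply: strong_between (DS _ xD) (DS _ yD) xy _; apply: blk Dss xD yD.
have [x xD] : exists x, x \in D by case: (D) D2 => // x D' _; exists x; rewrite inE eqxx.
have bx := Db x xD; have /and3P[_ wx xv] := bx.
split=> // [|y]; first exact: connect_trans wx xv.
apply/idP/idP => [/Db//|by'].
have [D' [D'ss xD' yD']] := ex _ _ (between_S bx) (between_S by') (between_strong bx by').
by rewrite (flatten_block_inj u Dss D'ss xD xD').
Qed.

Lemma component_time : new_component_time scc S A <= (2 * c + 2) * size S ^ 2.
Proof.
have [_ _ _] := sccP A (re_uniq re); rewrite -/S /new_component_time.
have := num_arcs_bound S A; have : size S <= size S ^ 2 by rewrite -mulnn; nia.
move: (scc S A).2 (num_arcs S A) (size S) => t a q; move: (q ^ 2) => q2; nia.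
Qed.

End Component.

(** * Deletion and renumbering of slots *)

Section Pmap.
Variables (T : eqType) (g : nat -> option T) (pos : T -> nat).
Hypothesis g_pos : forall p x, g p = Some x -> pos x = p.

Lemma mem_pmap_iota a N x :
  reflect (exists2 p, a <= p < a + N & g p = Some x) (x \in pmap g (iota a N)).
Proof.
rewrite mem_pmap; apply: (iffP mapP) => [[p]|[p ap gp]].
  by rewrite mem_iota => ap ->; exists p.
by exists p; rewrite ?mem_iota.
Qed.

Lemma pairwise_pmap_iota a N : pairwise (relpre pos ltn) (pmap g (iota a N)).
Proof.
elim: N a => //= N IH a; case ga: (g a) => [x|] //=; rewrite IH andbT.
apply/allP => y /mem_pmap_iota[p /andP[ap _] /g_pos yp] /=.
by rewrite (g_pos ga) yp.
Qed.

Lemma index_pmap_iota a N x : a <= pos x < a + N -> g (pos x) = Some x ->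
  (forall p, a <= p <= pos x -> g p != None) ->
  a + index x (pmap g (iota a N)) = pos x.
Proof.
elim: N a => [|N IH] a /=; first by lia.
move=> ax gx full; case: (ltngtP a (pos x)) => [lt|gt|eq]; last 2 first.
- by move: ax gt; clear; lia.
- by rewrite eq gx /= eqxx addn0.
case ga: (g a) => [y|]; last by have := full a; rewrite leqnn (ltnW lt) ga => /(_ isT).
have ya : (y == x) = false.
  by apply/eqP => e; have := g_pos ga; rewrite e => /eqP; rewrite gtn_eqF.
rewrite /= ya addnS -addSn IH //; first by rewrite lt addSnnS; case/andP: ax.
by move=> p /andP[ap px]; apply: full; rewrite px (ltnW ap).
Qed.

End Pmap.

Lemma onth_index (T : eqType) (s : seq T) p x : uniq s ->
  onth s p = Some x <-> x \in s /\ index x s = p.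
Proof.
elim: s p => [|y s IH] [|p] /=; try by split=> // -[].
  by move=> _; rewrite inE; case: eqVneq => [->|xy]; split=> // -[] // e;
     rewrite e eqxx in xy.
move=> /andP[ys us]; have := IH p us; rewrite /onth /= => IHp.
rewrite inE; case: eqVneq => [e|xy].
  by split=> [/IHp[xs]|[_ //]]; rewrite -e xs in ys.
by split=> [/IHp[-> ->]|[xs [e]]] //; apply/IHp.
Qed.

(** It limits how far the renumbering after a contraction can lower a position. *)
Lemma index_filter (T : eqType) (a : pred T) s x : a x ->
  index x s <= index x (filter a s) + count (predC a) s.
Proof.
move=> ax; elim: s => //= y s IH; case: eqP => [->|yx]; first by rewrite leq0n.
case ay: (a y) => /=; last by rewrite add1n addnS ltnS.
by case: eqP => // _; rewrite add0n addSn ltnS.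
Qed.

(** * Preservation of validity by an arc addition *)

Section Preservation.
Variables (n : nat) (E : rel 'I_n) (s : state n) (v0 w0 : 'I_n).
Hypothesis sV : valid E s.
Let E' := add_rel E v0 w0.
Notation v := (canon s v0).
Notation w := (canon s w0).
Notation pos := (position s).
Let A := adj (set_arc s v w).

Lemma connect_weaken x y : connect E x y -> connect E' x y.
Proof. exact: connect_rel_add. Qed.

Lemma connect_new : connect E' v w.
Proof.
have /andP[_ vv] := canon_connect sV v0; have /andP[ww _] := canon_connect sV w0.
apply: connect_trans (connect_weaken vv) _.
by apply: connect_trans (connect_new_arc E v0 w0) (connect_weaken ww).
Qed.

Lemma connect_inv x y : connect E' x y ->
  connect E x y \/ connect E x v /\ connect E w y.
Proof.
move/connect_add_rel=> [|[xv wy]]; [by left|right].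
have /andP[vv _] := canon_connect sV v0; have /andP[_ ww] := canon_connect sV w0.
by split; [apply: connect_trans xv vv|apply: connect_trans ww wy].
Qed.

Lemma canon_connect_weaken x : connect E' x (canon s x) && connect E' (canon s x) x.
Proof. by have /andP[a b] := canon_connect sV x; rewrite !connect_weaken. Qed.

Lemma arc_adjA x y : E' x y -> canon s x = canon s y \/ A (canon s x) (canon s y).
Proof.
rewrite /E' /A /= => /orP[/andP[/eqP-> /eqP->]|]; first by right; rewrite !eqxx.
by move=> /(arc_adj sV)[|xy]; [left|right; rewrite xy orbT].
Qed.

Lemma adjA_connect x y : live s x -> live s y -> A x y -> connect E' x y.
Proof.
move=> Lx Ly; rewrite /A /= => /orP[/andP[/eqP-> /eqP->]|xy]; first exact: connect_new.
exact/connect_weaken/(adj_connect sV Lx Ly xy).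
Qed.

Lemma valid_inside : v = w -> valid E' s.
Proof.
move=> vw; split; [exact: canonK sV|exact: canon_connect_weaken|
  |  |exact: vertexP sV|exact: position_range sV|exact: position_topological sV].
- by move=> x y /orP[/andP[/eqP-> /eqP->]|/(arc_adj sV)//]; left.
- by move=> x y Lx Ly xy; apply/connect_weaken/(adj_connect sV Lx Ly xy).
Qed.

Lemma valid_set_arc : v <> w -> pos v <= pos w -> valid E' (set_arc s v w).
Proof.
move=> vw le; split; [exact: canonK sV|exact: canon_connect_weaken|exact: arc_adjA|
  exact: adjA_connect|exact: vertexP sV|exact: position_range sV|].
move=> x y Lx Ly /orP[/andP[/eqP-> /eqP->]|xy]; last exact: (position_topological sV Lx Ly xy).
rewrite ltn_neqAle le andbT; apply/eqP => e; apply: vw.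
exact: (position_inj sV (live_canon sV _) (live_canon sV _) e).
Qed.

Variables (vtx' : nat -> option 'I_n) (pos' : 'I_n -> nat) (F B : seq 'I_n) (k : nat).
Hypothesis wv : pos w < pos v.
Hypothesis re : reordered E s v w vtx' pos' F B k.

Lemma valid_acyclic : ~~ connect E w v -> valid E' (State (canon s) pos' vtx' A).
Proof.
move=> nwv; split; [exact: canonK sV|exact: canon_connect_weaken|exact: arc_adjA|
  exact: adjA_connect|exact: (re_vertex re)|exact: (re_range re)|].
move=> x y Lx Ly xy; apply: (re_order re Lx Ly xy).
apply: contra nwv => /andP[wx yv].
exact: connect_trans (adjA_reach sV Lx Ly xy wx) yv.
Qed.

Lemma pos'_inj x y : live s x -> live s y -> pos' x = pos' y -> x = y.
Proof.
move=> Lx Ly e; have /(re_vertex re) ex : live s x /\ pos' x = pos' y by [].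
have /(re_vertex re) : live s y /\ pos' y = pos' y by [].
by rewrite ex => -[].
Qed.

Variable D : seq 'I_n.
Hypotheses (wv_E : connect E w v) (D_uniq : uniq D).
Hypothesis D_mem : forall x, (x \in D) = between E s v w x.

(** The canonical vertex can be taken to be [w] because [re_root] places it in slot [k]. *)
Let t := contract (canon s) vtx' A D w.
Let l := pmap vtx' (iota 1 n).
Let order := [seq x <- l | canon t x == x].

Lemma live_n : #|live s| <= n.
Proof. by rewrite -[X in _ <= X]card_ord max_card. Qed.

Lemma vtx'_pos p x : vtx' p = Some x -> pos' x = p.
Proof. by case/(re_vertex re). Qed.

Lemma mem_slots x : (x \in l) = live s x.
Proof.
apply/mem_pmap_iota/idP => [[p _ /(re_vertex re)[]]//|Lx].
exists (pos' x); last exact/(re_vertex re).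
by have := re_range re Lx; have := live_n; lia.
Qed.

Lemma w_D : w \in D.
Proof. by rewrite D_mem /between connect0 wv_E (live_canon sV). Qed.

Lemma v_D : v \in D.
Proof. by rewrite D_mem /between connect0 wv_E (live_canon sV). Qed.

Lemma D_live x : x \in D -> live s x.
Proof. by rewrite D_mem => /and3P[]. Qed.

Lemma live_contract x : live t x = (x == w) || live s x && (x \notin D).
Proof.
rewrite /live /=; case: ifP => xD.
  rewrite eq_sym; case: eqVneq => //= _; apply/esym/negP => /andP[/eqP e].
  by rewrite e in xD; rewrite xD.
have -> : (x == w) = false.
  by apply/negP => /eqP e; move: xD; rewrite e (canonK sV) w_D.
by case: eqP => //= e; rewrite e in xD; rewrite xD.
Qed.

Lemma mem_order x : (x \in order) = live t x.
Proof.
rewrite mem_filter mem_slots; apply/andP/idP => [[]//|Lt]; split=> //.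
by move: Lt; rewrite live_contract => /orP[/eqP->|/andP[]//]; rewrite (live_canon sV).
Qed.

Lemma slots_pairwise : pairwise (relpre pos' ltn) l.
Proof. by apply: pairwise_pmap_iota; apply: vtx'_pos. Qed.

Lemma slots_uniq : uniq l.
Proof. by apply: pairwise_uniq slots_pairwise => x /=; rewrite ltnn. Qed.

Lemma order_uniq : uniq order.
Proof. exact/filter_uniq/slots_uniq. Qed.

Lemma size_order : size order = #|live t|.
Proof. by rewrite -(card_uniqP order_uniq); apply: eq_card => x; rewrite mem_order. Qed.

Lemma card_live_contract : #|live s| + 1 = #|live t| + size D.
Proof.
rewrite -(card_uniqP D_uniq) -(cardID (mem D) (live s)).
have -> : #|[predI live s & D]| = #|D|.
  apply: eq_card => x; rewrite inE /=; case xD: (x \in D); rewrite ?andbF //.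
  by rewrite andbT; apply: D_live.
have -> : #|live t| = #|predU1 w [predD live s & D]|.
  apply: eq_card => x; rewrite -[x \in live t]/(live t x) live_contract !inE /=.
  by congr (_ || _); exact: andbC.
have wD : w \notin [predD live s & D] by rewrite !inE /= w_D.
by rewrite cardU1 wD -addnA [RHS]addnC; congr (_ + _); rewrite addnC.
Qed.

Lemma order_sorted x y : live t x -> live t y -> pos' x < pos' y ->
  position t x < position t y.
Proof.
rewrite -!mem_order => xo yo lt; rewrite ltnS.
apply: (@pairwise_index _ (relpre pos' ltn)) => //=.
- exact: subseq_pairwise (filter_subseq _ _) slots_pairwise.
- by apply: contraTneq lt => ->; rewrite ltnn.
- by rewrite -leqNgt ltnW.
Qed.

(** Before the deletion the slots are full, so a position is an index in [l], and all entries
    removed from [l] belong to [D]. *)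
Lemma position_contract x : live t x -> pos' x <= position t x + size D.
Proof.
move=> Lt; have Lx : live s x by rewrite -mem_slots; move: Lt; rewrite -mem_order mem_filter => /andP[].
have x_range := re_range re Lx; have := live_n => mn.
have <- : 1 + index x l = pos' x.
  apply: index_pmap_iota.
  - exact: vtx'_pos.
  - by move: x_range mn; clear; lia.
  - exact/(re_vertex re).
  move=> p px; have : p \in iota 1 #|live s|.
    by rewrite mem_iota; move: px x_range; clear; lia.
  rewrite -(perm_mem (perm_image_iota pos'_inj (re_range re))) => /mapP[y].
  by rewrite mem_enum => Ly yp; have /(re_vertex re) -> : live s y /\ pos' y = p.
rewrite add1n /= -/order addSn ltnS.
apply: leq_trans (index_filter l Lt) _; rewrite leq_add2l.
have <- : count (mem D) D = size D by apply/eqP; rewrite -all_count; apply/allP.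
rewrite -size_filter -(size_filter (mem D) D); apply: uniq_leq_size.
  exact/filter_uniq/slots_uniq.
move=> y; rewrite !mem_filter /= mem_slots => /andP[nLt Ly].
have : ~~ live t y := nLt.
by rewrite live_contract Ly /= negb_or negbK => /andP[_ yD]; rewrite yD.
Qed.

Lemma live_contract_live x : live t x -> live s x.
Proof. by rewrite live_contract => /orP[/eqP->|/andP[]//]; rewrite (live_canon sV). Qed.

(** The whole component is now compared through slot [k], while [re_order] speaks of the old end
    [x'] or [y'] in [D]. If that end lies on the wrong side of [k], it was carried there by the
    reordering, and its old position was on the right side; the other end either kept its position
    or moved to the right side of [k], since it cannot both be reachable from [w] and reach [v]. *)
Lemma contract_topological x y : live t x -> live t y -> adj t x y -> pos' x < pos' y.
Proof.
have Lw := live_canon sV w0; have Lv := live_canon sV v0; have pw := re_root re.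
have D_FB z : z \in D -> z \in F ++ B.
  by rewrite D_mem => /and3P[]; apply: (re_between re).
rewrite !live_contract /= => Lx Ly /andP[xy /hasP[x' + /hasP[y' + x'y']]].
have [ex|xw] := eqVneq x w; have [ey|yw] := eqVneq y w.
- by rewrite ex ey eqxx in xy.
- rewrite ex pw mem_seq1 => x'D /eqP ey'; subst y'.
  rewrite (negPf yw) /= in Ly; have /andP[{}Ly yD] := Ly.
  have Lx' := D_live x'D; have := x'D; rewrite D_mem => /and3P[_ wx' _].
  have wy := adjA_reach sV Lx' Ly x'y' wx'.
  have nyv : ~~ connect E y v by apply: contra yD => yv; rewrite D_mem; apply/and3P.
  have lt := re_order re Lx' Ly x'y'; rewrite (negPf nyv) andbF in lt.
  have {}lt := lt isT.
  case: (leqP k (pos' x')) => [kx|x'k]; first exact: leq_ltn_trans kx lt.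
  have x'B : x' \in B.
    have := D_FB _ x'D; rewrite mem_cat => /orP[/(re_front re)[_ _ /andP[_]]|//].
    by rewrite leqNgt x'k.
  have [_ _ /andP[_ kx']] := re_back re x'B.
  case: (re_moved re Ly) => [->|[_ ky _]|[yv _ _]]; last by rewrite yv in nyv.
    case: (adjA_position sV Lx' Ly x'y') => [[_ yw']|]; first by rewrite yw' eqxx in yw.
    exact: leq_ltn_trans.
  rewrite ltn_neqAle ky andbT; apply: contraNneq yw => ky'; apply/eqP.
  by apply: (pos'_inj Ly Lw); rewrite pw.
- rewrite ey pw mem_seq1 => /eqP ex' y'D; subst x'.
  rewrite (negPf xw) /= in Lx; have /andP[{}Lx xD] := Lx.
  have Ly' := D_live y'D; have := y'D; rewrite D_mem => /and3P[_ _ y'v].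
  have xv := adjA_coreach sV Lx Ly' x'y' y'v.
  have nwx : ~~ connect E w x by apply: contra xD => wx; rewrite D_mem; apply/and3P.
  have lt := re_order re Lx Ly' x'y'; rewrite (negPf nwx) in lt.
  have {}lt := lt isT.
  case: (leqP (pos' y') k) => [yk|ky']; first exact: leq_trans lt yk.
  have y'F : y' \in F.
    have := D_FB _ y'D; rewrite mem_cat => /orP[//|/(re_back re)[_ _ /andP[+ _]]].
    by rewrite ltnNge ltnW.
  have [_ _ /andP[yk _]] := re_front re y'F.
  case: (re_moved re Lx) => [->|[wx _ _]|[]//]; last by rewrite wx in nwx.
  case: (adjA_position sV Lx Ly' x'y') => [[xv' _]|]; first by rewrite xv' v_D in xD.
  by move=> h; apply: leq_trans h yk.
- rewrite !mem_seq1 => /eqP ex' /eqP ey'; subst x' y'.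
  rewrite (negPf xw) /= in Lx; have /andP[{}Lx xD] := Lx.
  rewrite (negPf yw) /= in Ly; have /andP[{}Ly yD] := Ly.
  apply: (re_order re Lx Ly x'y'); apply: contra xD => /andP[wx yv].
  by rewrite D_mem; apply/and3P; split=> //; exact: (adjA_coreach sV Lx Ly x'y' yv).
Qed.

Lemma between_equiv x : x \in D -> connect E' x w && connect E' w x.
Proof.
rewrite D_mem => /and3P[_ wx xv]; rewrite (connect_weaken wx) andbT.
exact: connect_trans (connect_weaken xv) connect_new.
Qed.

Lemma old_equiv z z' : z' \in (if z == w then D else [:: z]) ->
  connect E' z z' && connect E' z' z.
Proof.
case: eqP => [->|_]; last by rewrite inE => /eqP->; rewrite connect0.
by move/between_equiv; rewrite andbC.
Qed.

Lemma valid_contract : valid E' t.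
Proof.
split.
- move=> x /=; case xD: (canon s x \in D); first by rewrite (canonK sV) w_D.
  by rewrite (canonK sV) xD.
- move=> x /=; have /andP[xc cx] := canon_connect_weaken x.
  case: ifP => [xD|_]; last by rewrite xc cx.
  have /andP[cw wc] := between_equiv xD.
  by rewrite (connect_trans xc cw) (connect_trans wc cx).
- move=> x y xy /=; case: (arc_adjA xy) => [->|a]; first by left.
  set x' := if _ then _ else _; set y' := if _ \in _ then _ else _.
  have old z : canon s z \in
      (if (if canon s z \in D then w else canon s z) == w then D
       else [:: if canon s z \in D then w else canon s z]).
    case zD: (canon s z \in D); first by rewrite eqxx zD.
    have -> : (canon s z == w) = false by apply: contraFF zD => /eqP->; rewrite w_D.
    by rewrite inE eqxx.
  have [->|ne] := eqVneq x' y'; [by left|right; rewrite ?ne /=].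
  apply/hasP; exists (canon s x); first exact: old.
  by apply/hasP; exists (canon s y) => //; apply: old.
- move=> x y Lx Ly /= /andP[_ /hasP[x' x'old /hasP[y' y'old x'y']]].
  have /andP[xx' _] := old_equiv x'old; have /andP[_ y'y] := old_equiv y'old.
  have oldL z z' : live t z -> z' \in (if z == w then D else [:: z]) -> live s z'.
    move=> /live_contract_live Lz; case: eqP => _; first exact: D_live.
    by rewrite inE => /eqP->.
  have := adjA_connect (oldL _ _ Lx x'old) (oldL _ _ Ly y'old) x'y'.
  by move=> x'y'E; apply: connect_trans xx' (connect_trans x'y'E y'y).
- move=> [|p] x /=; first by split=> // -[].
  rewrite -/order (onth_index _ _ order_uniq) mem_order.
  by split=> [[-> ->]|[-> [->]]].
- by move=> x Lx /=; rewrite -size_order index_mem mem_order.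
- by move=> x y Lx Ly xy; apply: order_sorted => //; apply: contract_topological.
Qed.

End Preservation.

(** * Amortization *)

Section Potential.
Variables (n : nat) (psi : 'I_n -> nat) (b : nat).
Hypothesis psi_b : forall x, psi x <= b.

Definition weight (L : pred 'I_n) (p : 'I_n -> nat) : nat :=
  \sum_(x | L x) psi x * p x.

Definition related (C : pred ('I_n * 'I_n)) (E : rel 'I_n) : nat :=
  #|[set p | connect E p.1 p.2 && C p]|.

Definition same_block : pred ('I_n * 'I_n) := fun p => psi p.1 == psi p.2.

Lemma related_mono C (E E' : rel 'I_n) :
  (forall x y, connect E x y -> connect E' x y) -> related C E <= related C E'.
Proof.
move=> sub; apply/subset_leq_card/subsetP => -[x y]; rewrite !inE /=.
by case/andP=> /sub-> ->.
Qed.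

Lemma related_gain (C : pred ('I_n * 'I_n)) (E E' : rel 'I_n) (F B : seq 'I_n) :
  (forall x y, connect E x y -> connect E' x y) -> uniq F -> uniq B ->
  (forall z u : 'I_n, z \in B -> u \in F ->
     [/\ connect E' z u, ~~ connect E z u & C (z, u)]) ->
  related C E + size F * size B <= related C E'.
Proof.
move=> sub uF uB new; rewrite mulnC.
set old := [set p | connect E p.1 p.2 && C p].
pose X := setX [set z in B] [set u in F].
have -> : size B * size F = #|X| by rewrite cardsX !cardsE !(card_uniqP _).
have disj : old :&: X = set0.
  apply/setP => -[x y]; rewrite !inE /=; apply/negP.
  by case/andP=> /andP[xy _] /andP[xB yF]; have [_] := new _ _ xB yF; rewrite xy.
rewrite /related -/old -[X in X <= _]subn0 -[X in _ - X](cards0 ('I_n * 'I_n)%type).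
rewrite -disj -cardsU; apply/subset_leq_card/subsetP => -[x y]; rewrite !inE /=.
case/orP=> [/andP[/sub-> ->]//|/andP[xB yF]].
by have [-> _ ->] := new _ _ xB yF.
Qed.

Lemma sum_mem (L : pred 'I_n) (Q : seq 'I_n) (g : 'I_n -> nat) : uniq Q ->
  (forall x, x \in Q -> L x) -> \sum_(x <- Q) g x = \sum_(x | L x) (x \in Q) * g x.
Proof.
move=> uQ QL; rewrite big_uniq //= big_mkcond [RHS]big_mkcond /=.
apply: eq_bigr => x _; case xQ: (x \in Q); last by rewrite mul0n if_same.
by rewrite (QL x xQ) mul1n.
Qed.

Section Step.
Variables (E : rel 'I_n) (s : state n) (v0 w0 : 'I_n).
Hypothesis sV : valid E s.
Let E' := add_rel E v0 w0.
Notation v := (canon s v0).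
Notation w := (canon s w0).
Notation pos := (position s).
Hypothesis psi_mono : forall x y, connect E' x y -> ~~ connect E' y x -> psi x <= psi y.
Hypothesis wv : pos w < pos v.
Variables (vtx' : nat -> option 'I_n) (pos' : 'I_n -> nat) (F B : seq 'I_n) (k : nat).
Hypothesis re : reordered E s v w vtx' pos' F B k.
Variable D : seq 'I_n.
Hypotheses (D_uniq : uniq D) (D_mem : forall x, (x \in D) = between E s v w x).

Definition central : pred 'I_n := fun x => (psi x == psi w) && (psi v == psi w).

(** After the addition [v] and [w] both reach [x]. A path back would put [x] in the new component or
    make it equal to [w], so [psi_mono] applies to both. *)
Lemma psi_forward x : live s x -> x \notin D -> connect E w x ->
  psi w <= psi x /\ psi v <= psi x.
Proof.
move=> Lx; rewrite D_mem /between Lx /= => xD wx; rewrite wx /= in xD.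
have Lw := live_canon sV w0.
have vx : connect E' v x.
  by apply: connect_trans (connect_new v0 w0 sV) (connect_weaken v0 w0 wx).
split.
  case xw: (connect E' x w); last by apply: psi_mono (connect_weaken v0 w0 wx) (negbT xw).
  case: (connect_inv sV xw) => [xw'|[xv _]]; last by rewrite xv in xD.
  by rewrite (mutual_live sV Lw Lx wx xw').
case xv: (connect E' x v); last by apply: psi_mono vx (negbT xv).
by case: (connect_inv sV xv) => [xv'|[xv' _]]; rewrite xv' in xD.
Qed.

Lemma psi_backward x : live s x -> x \notin D -> connect E x v ->
  psi x <= psi w /\ psi x <= psi v.
Proof.
move=> Lx; rewrite D_mem /between Lx /= => xD xv; rewrite xv andbT in xD.
have Lv := live_canon sV v0.
have xw : connect E' x w.
  by apply: connect_trans (connect_weaken v0 w0 xv) (connect_new v0 w0 sV).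
split.
  case wx: (connect E' w x); last by apply: psi_mono xw (negbT wx).
  by case: (connect_inv sV wx) => [wx'|[_ wx']]; rewrite wx' in xD.
case vx: (connect E' v x); last by apply: psi_mono (connect_weaken v0 w0 xv) (negbT vx).
case: (connect_inv sV vx) => [vx'|[_ wx]]; last by rewrite wx in xD.
by rewrite (mutual_live sV Lv Lx vx' xv).
Qed.

(* Summed over the live vertices, the terms in [psi v + psi w] cancel. *)
Lemma vertex_gain x : live s x ->
  (x \in F) * (k - pos x) + (x \in B) * (pos x - k) +
    ((psi v + psi w) * pos' x + 2 * (psi x * pos x)) <=
  2 * (psi x * pos' x) + (psi v + psi w) * pos x +
    n * (((x \in F) + (x \in B)) * central x) + (x \in D) * ((2 * b + 1) * n).
Proof.
move=> Lx; have mn := live_n s.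
have px : pos x <= n by have := position_range sV Lx; move: mn; clear; lia.
have px' : pos' x <= n by have := re_range re Lx; move: mn; clear; lia.
have kn : k <= n.
  have := re_range re (live_canon sV w0); rewrite (re_root re).
  by move: mn; clear; lia.
have disj : x \in F -> (x \in B) = false.
  by move=> xF; apply/negP => xB; have := re_front_back re xF xB; rewrite ltnn.
have Fx : x \in F -> pos x <= k <= pos' x by case/(re_front re).
have Bx : x \in B -> pos' x < k <= pos x by case/(re_back re).
have pv := psi_b v; have pw := psi_b w; have pb := psi_b x.
(* Inside the new component [psi] gives no inequality, so everything is bounded by its maximum: [n]
   for the distance to [k], and [2 * b * n] for the one product that goes the wrong way. *)
case xD: (x \in D).
  have th : (x \in F) * (k - pos x) + (x \in B) * (pos x - k) <= n.
    case xF: (x \in F); first by rewrite disj // mul1n mul0n addn0; move: kn; clear; lia.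
    by case: (x \in B); rewrite ?mul1n ?mul0n; move: px; clear; lia.
  move: th (_ * (_ * central x)); set th := _ + _ => th_n z.
  move: px px' pv pw pb th_n; rewrite mul1n; clear.
  move: (pos x) (pos' x) (psi v) (psi w) (psi x) th => p p' q1 q2 q th.
  move=> pn pn' q1b q2b qb thn.
  have h1 : (q1 + q2) * p' <= (q1 + q2) * p + 2 * b * n by nia.
  have h2 : 2 * (q * p) <= 2 * (q * p') + 2 * b * n by nia.
  case: (leqP p p') => le.
    have : q * p <= q * p' by rewrite leq_mul2l le orbT.
    by move: h1 thn; clear; nia.
  have : (q1 + q2) * p' <= (q1 + q2) * p by rewrite leq_mul2l ltnW ?orbT.
  by move: h2 thn; clear; nia.
rewrite mul0n addn0; have nD := negbT xD.
case: (re_moved re Lx) => [e|[wx kx le]|[xv kx le]].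
- have -> : (x \in F) * (k - pos x) + (x \in B) * (pos x - k) = 0.
    case xF: (x \in F); first by rewrite disj //; have := Fx xF; rewrite e; clear; lia.
    case xB: (x \in B); last by rewrite !mul0n.
    by have := Bx xB; rewrite e; clear; lia.
  by rewrite e; clear; nia.
(* The gain is [2 * psi x - psi v - psi w] times the displacement. The factor is at least 1 unless
   [psi x], [psi v] and [psi w] coincide, and for [x] in [F] the displacement is at least
   [k - pos x]. *)
- have [h1 h2] := psi_forward Lx nD wx.
  have -> : (x \in B) = false.
    by apply/negP => /Bx /andP[h _]; move: h kx; clear; lia.
  case xF: (x \in F); last first.
    rewrite !mul0n muln0 addn0 !add0n; move: h1 h2 le; clear.
    move: (pos x) (pos' x) (psi v) (psi w) (psi x) => p p' q1 q2 q h1 h2 le; nia.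
  have := Fx xF; rewrite /central mul1n mul0n !addn0 mul1n.
  case: (eqVneq (psi x) (psi w)) => [e1|ne1]; last first.
    rewrite muln0 addn0 => /andP[_ kx']; have : psi w < psi x by rewrite ltn_neqAle eq_sym ne1.
    move: h2 le kx'; clear.
    move: (pos x) (pos' x) (psi v) (psi w) (psi x) => p p' q1 q2 q h2 le kp h1; nia.
  case: (eqVneq (psi v) (psi w)) => [e2|ne2].
    rewrite e1 e2 muln1 => _; move: kn; clear; lia.
  rewrite muln0 addn0 => /andP[_ kx'].
  have : psi v < psi x by rewrite e1 ltn_neqAle ne2 -e1.
  move: h1 le kx'; clear.
  move: (pos x) (pos' x) (psi v) (psi w) (psi x) => p p' q1 q2 q h2 le kp h1; nia.
have [h1 h2] := psi_backward Lx nD xv.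
have -> : (x \in F) = false.
  by apply/negP => /Fx /andP[_ h]; move: h kx; clear; lia.
case xB: (x \in B); last first.
  rewrite !mul0n muln0 addn0 !add0n; move: h1 h2 le; clear.
  move: (pos x) (pos' x) (psi v) (psi w) (psi x) => p p' q1 q2 q h1 h2 le; nia.
have := Bx xB; rewrite /central mul1n mul0n !add0n mul1n.
case: (eqVneq (psi x) (psi w)) => [e1|ne1]; last first.
  rewrite muln0 addn0 => /andP[kx' _]; have : psi x < psi w by rewrite ltn_neqAle ne1.
  move: h2 le kx'; clear.
  move: (pos x) (pos' x) (psi v) (psi w) (psi x) => p p' q1 q2 q h2 le kp h1; nia.
case: (eqVneq (psi v) (psi w)) => [e2|ne2].
  by rewrite e1 e2 muln1 => _; move: px; clear; lia.
rewrite muln0 addn0 => /andP[kx' _].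
have : psi x < psi v by rewrite e1 ltn_neqAle eq_sym ne2 -e1.
move: h1 le kx'; clear.
move: (pos x) (pos' x) (psi v) (psi w) (psi x) => p p' q1 q2 q h2 le kp h1; nia.
Qed.

Lemma sum_positions : \sum_(x | live s x) pos' x = \sum_(x | live s x) pos x.
Proof.
have sumE (f : 'I_n -> nat) : perm_eq [seq f x | x in live s] (iota 1 #|live s|) ->
    \sum_(x | live s x) f x = \sum_(p <- iota 1 #|live s|) p.
  by move=> /(perm_big _) <-; rewrite big_map big_enum.
rewrite !sumE //; first exact: positions_perm sV.
exact: (perm_image_iota (pos'_inj re) (re_range re)).
Qed.

Lemma weight_gain :
  search_cost s F B k + 2 * weight (live s) pos <=
  2 * weight (live s) pos' + n * (count central F + count central B) +
    size D * ((2 * b + 1) * n).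
Proof.
have uFB := re_uniq re; rewrite cat_uniq in uFB; have /and3P[uF _ uB] := uFB.
have FL x : x \in F -> live s x by case/(re_front re).
have BL x : x \in B -> live s x by case/(re_back re).
have DL x : x \in D -> live s x by rewrite D_mem => /and3P[].
have cE Q : count central Q = \sum_(x <- Q) central x.
  by rewrite -sum1_count [LHS]big_mkcond; apply: eq_bigr => x _; case: ifP.
have sD : size D * ((2 * b + 1) * n) = \sum_(x <- D) (2 * b + 1) * n.
  by rewrite big_const_seq count_predT iter_addn_0 mulnC.
rewrite /search_cost sD !cE /weight.
rewrite !(sum_mem _ uF FL) !(sum_mem _ uB BL) (sum_mem _ D_uniq DL).
have -> : \sum_(x | live s x) (x \in F) * central x +
    \sum_(x | live s x) (x \in B) * central x =
    \sum_(x | live s x) ((x \in F) + (x \in B)) * central x.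
  by rewrite -big_split; apply: eq_bigr => x _; rewrite mulnDl.
have sums (t c : nat) (f1 f2 p p' q q' z d : 'I_n -> nat) :
    (forall x, live s x -> f1 x + f2 x + (c * p' x + t * q x) <=
       t * q' x + c * p x + n * z x + d x) ->
    \sum_(x | live s x) f1 x + \sum_(x | live s x) f2 x +
      (c * \sum_(x | live s x) p' x + t * \sum_(x | live s x) q x) <=
    t * \sum_(x | live s x) q' x + c * \sum_(x | live s x) p x +
      n * \sum_(x | live s x) z x + \sum_(x | live s x) d x.
  by move=> le; rewrite !big_distrr -!big_split /=; apply: leq_sum.
have := sums _ _ _ _ _ _ _ _ _ _ vertex_gain.
have cancel a u p q z d : a + (p + u) <= q + p + z + d -> a + u <= q + z + d.
  by clear; lia.
by rewrite sum_positions => /cancel.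
Qed.

Lemma front_back_new z u : z \in B -> u \in F -> connect E' z u /\ ~~ connect E z u.
Proof.
move=> zB uF; have [Lu wu _] := re_front re uF; have [Lz zv _] := re_back re zB.
split.
  apply: connect_trans (connect_weaken v0 w0 zv) _.
  exact: connect_trans (connect_new v0 w0 sV) (connect_weaken v0 w0 wu).
apply/negP => zu; have lt := re_front_back re uF zB.
by case: (connect_position sV Lz Lu zu) => [e|]; move: lt; rewrite ?e; clear; lia.
Qed.

(** Central vertices of [B] and [F] form newly related pairs within one block. If any vertex is
    central, so are [w] in [F] and [v] in [B]; both counts [f], [g] are then positive and
    [f + g <= 2 * f * g]. *)
Lemma central_gain : count central F + count central B <=
  2 * (related same_block E' - related same_block E).
Proof.
have uFB := re_uniq re; rewrite cat_uniq in uFB; have /and3P[uF _ uB] := uFB.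
have := @related_gain same_block E E' (filter central F) (filter central B)
  (fun x y => @connect_weaken _ E v0 w0 x y) (filter_uniq _ uF) (filter_uniq _ uB).
rewrite !size_filter => gain.
have {gain} : related same_block E + count central F * count central B <=
    related same_block E'.
  apply: gain => z u; rewrite !mem_filter => /andP[/andP[/eqP zw _] zB] /andP[/andP[/eqP uw _] uF'].
  have [-> ->] := front_back_new zB uF'.
  by split=> //; rewrite /same_block /= zw uw.
have [vw|vw] := eqVneq (psi v) (psi w).
  have : 0 < count central F.
    by rewrite -has_count; apply/hasP; exists w; rewrite ?(re_w re) // /central vw !eqxx.
  have : 0 < count central B.
    by rewrite -has_count; apply/hasP; exists v; rewrite ?(re_v re) // /central vw !eqxx.
  move: (count central F) (count central B) (related _ E) (related _ E'); clear.
  by move=> f g r r'; nia.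
have none Q : count central Q = 0.
  by apply/eqP; rewrite eqn0Ngt -has_count; apply/hasPn => x _; rewrite /central (negPf vw) andbF.
by rewrite !none.
Qed.

(** The alternating search keeps the two lengths within one of each other, so the square is at most
    [6 * size F * size B]. This pays for the quadratic work of finding the new component. *)
Lemma size_gain : (size F + size B) ^ 2 <= 6 * (related predT E' - related predT E).
Proof.
have uFB := re_uniq re; rewrite cat_uniq in uFB; have /and3P[uF _ uB] := uFB.
have := @related_gain predT E E' F B (fun x y => @connect_weaken _ E v0 w0 x y) uF uB.
move=> gain; have {gain} : related predT E + size F * size B <= related predT E'.
  by apply: gain => z u zB uF'; have [-> ->] := front_back_new zB uF'.
have : 0 < size B by case: (B) (re_v re).
have := re_size re.
move: (size F) (size B) (related _ E) (related _ E'); clear => f g r r' fg g_gt0 gain.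
have le : f * g <= r' - r by move: gain; clear; lia.
apply: leq_trans (_ : 6 * (f * g) <= _); last by rewrite leq_mul2l le.
have [->|->] : f = g \/ f = g.+1 by move: fg; clear; lia.
  by rewrite -mulnn; clear; nia.
by rewrite -mulnn; move: g_gt0; clear; nia.
Qed.

End Step.
End Potential.

(** * Determinism, and the cost of one addition against the potential *)

Lemma search_and_reorder_det n scc (s : state n) v w t r t' r' :
  search_and_reorder scc s v w t r -> search_and_reorder scc s v w t' r' ->
  t = t' /\ r = r'.
Proof.
case=> {t r} t1 vtx1 F B k t2 vtx2 pos2 t3 vtx3 pos3 l1 l2 l3.
case=> {t' r'} u1 vtx1' F' B' k' u2 vtx2' pos2' u3 vtx3' pos3' m1 m2 m3.
have [-> [? ? ? ?]] := loop_det l1 m1; subst.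
have [-> [? ?]] := loop_det l2 m2; subst.
by have [-> [-> ->]] := loop_det l3 m3.
Qed.

Lemma add_arc_det n scc (s : state n) v w t r t' r' :
  add_arc scc s v w t r -> add_arc scc s v w t' r' -> t = t' /\ r = r'.
Proof.
case=> [e|ne le|u vtx pos k ne lt run|u vtx pos k D x ne lt run vk];
  case=> [e'|ne' le'|u' vtx' pos' k' ne' lt' run'|u' vtx' pos' k' D' x' ne' lt' run' vk'] //;
  try (by []); try (by move: lt; rewrite ltnNge le'); try (by move: lt'; rewrite ltnNge le);
  have [eu er] := search_and_reorder_det run run'; case: er => *; subst => //.
by move: vk'; rewrite vk => -[->].
Qed.

Lemma add_arcs_det n scc (s : state n) arcs t r t' r' :
  add_arcs scc s arcs t r -> add_arcs scc s arcs t' r' -> t = t' /\ r = r'.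
Proof.
move=> run; elim: run t' r' => {s arcs t r} [s|s v w arcs t1 s1 t2 s2 h _ IH] t' r' run'.
  by inversion run'.
inversion run' as [|s3 v3 w3 arcs3 u1 r1 u2 r2 h' run2]; subst.
have [e1 e2] := add_arc_det h h'; subst.
by have [-> ->] := IH _ _ run2.
Qed.

Section Step.
Variables (n : nat) (E : rel 'I_n) (s : state n) (v0 w0 : 'I_n).
Hypothesis sV : valid E s.
Let E' := add_rel E v0 w0.
Notation v := (canon s v0).
Notation w := (canon s w0).
Notation pos := (position s).
Let A := adj (set_arc s v w).

(** The coefficients come from the time bound with [4 * search_cost]: [weight_gain] turns 4 into
    [8 * weight] and [4 * n] per central vertex, and [central_gain] doubles the latter. The factor
    [2 * c + 7] bounds the quadratic work, multiplied by the 6 of [size_gain]. The last term grows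
    with each deletion. *)
Definition potential (c : nat) (psi : 'I_n -> nat) (b : nat) (F : rel 'I_n) (st : state n) :=
  8 * weight psi (live st) (position st) + 8 * n * related (same_block psi) F +
  6 * (2 * c + 7) * related predT F + 48 * (n * (b + 1)) * (n - #|live st|).

(** Each survivor loses at most [size D] slots and each deleted vertex its whole position, at most
    [n]; both losses come with weight at most [b]. *)
Lemma weight_contract (psi : 'I_n -> nat) b vtx' pos' F B k D :
  (forall x, psi x <= b) -> pos w < pos v -> reordered E s v w vtx' pos' F B k ->
  connect E w v -> uniq D -> (forall x, (x \in D) = between E s v w x) ->
  forall t, t = contract (canon s) vtx' A D w ->
  weight psi (live s) pos' <=
  weight psi (live t) (position t) + 2 * (size D * (b * n)).
Proof.
move=> psi_b wv re wvE D_uniq D_mem t eqt.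
have liveE := live_contract sV vtx' wvE D_mem; rewrite -/A -eqt in liveE.
have tn : #|live t| <= n by apply: live_n.
rewrite /weight (bigID (live t)) /= mul2n -addnn addnA; apply: leq_add.
  rewrite (eq_bigl (live t)); last first.
    move=> x; apply/andP/idP => [[]//|Lt]; split=> //.
    by rewrite eqt in Lt; apply: (live_contract_live sV wvE D_mem Lt).
  apply: (@leq_trans (\sum_(x | live t x) (psi x * position t x + b * size D))).
    apply: leq_sum => x Lt.
    rewrite eqt in Lt; have := position_contract sV wv re wvE D_uniq D_mem Lt.
    rewrite -/A -eqt; have := psi_b x; move: (psi x) (pos' x) (position t x) (size D); clear.
    by move=> q p p' d qb h; apply: leq_trans (leq_mul (leqnn q) h) _; nia.
  rewrite big_split leq_add2l sum_nat_const /=.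
  by rewrite mulnA [X in X <= _]mulnC leq_mul2l [X in X <= _]mulnC leq_mul2l tn !orbT.
apply: (@leq_trans (\sum_(x <- D) b * n)); last first.
  by rewrite big_const_seq count_predT iter_addn_0 mulnC.
rewrite big_uniq //= [X in _ <= X]big_mkcond [X in X <= _]big_mkcond /=; apply: leq_sum => x _.
case: ifP => // /andP[Lx]; rewrite liveE Lx /= negb_or negbK => /andP[_ ->].
apply: leq_mul (psi_b x) _; have := re_range re Lx; have := live_n s; clear; lia.
Qed.

Variables (c : nat) (scc : seq 'I_n -> rel 'I_n -> seq (seq 'I_n) * nat).
Hypothesis sccP : linear_time_scc c scc.

Lemma potential_weaken psi b : potential c psi b E s <= potential c psi b E' s.
Proof.
rewrite /potential leq_add2r; apply: leq_add; last first.
  by rewrite leq_mul2l related_mono ?orbT //; apply: connect_weaken.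
rewrite leq_add2l leq_mul2l related_mono ?orbT //; apply: connect_weaken.
Qed.

Lemma search_time psi b vtx' pos' F B k D t :
  (forall x, psi x <= b) ->
  (forall x y, connect E' x y -> ~~ connect E' y x -> psi x <= psi y) ->
  pos w < pos v -> reordered E s v w vtx' pos' F B k ->
  uniq D -> (forall x, (x \in D) = between E s v w x) ->
  t <= 4 * search_cost s F B k + 5 * (size F + size B) + 3 +
       new_component_time scc (F ++ B) A ->
  t + (8 * weight psi (live s) pos + 8 * n * related (same_block psi) E +
       6 * (2 * c + 7) * related predT E) <=
  8 * weight psi (live s) pos' + 8 * n * related (same_block psi) E' +
  6 * (2 * c + 7) * related predT E' + 4 * (size D * ((2 * b + 1) * n)) + 3.
Proof.
move=> psi_b psi_mono wv re D_uniq D_mem time.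
have := component_time (live_canon sV v0) (live_canon sV w0) wv re sccP.
rewrite size_cat -/A => ct.
have := weight_gain psi_b sV psi_mono re D_uniq D_mem.
have := central_gain psi sV re; have := size_gain sV re; rewrite -/E'.
have mono C : related C E <= related C E'.
  by apply: related_mono; apply: connect_weaken.
have r1 := mono (same_block psi); have r2 := mono predT.
have q2 : size F + size B <= (size F + size B) ^ 2 by rewrite -mulnn; clear; nia.
move: (search_cost s F B k) (size F + size B) time ct q2 => th q time ct q2.
move: (related (same_block psi) E) (related (same_block psi) E') r1 => a a' r1.
move: (related predT E) (related predT E') r2 => d d' r2.
move: (count _ F + count _ B) (size D * _) (weight _ _ pos) (weight _ _ pos') => z X W W'.
move=> qd za thW; rewrite -(subnKC r1) -(subnKC r2).
have nz : n * z <= n * (2 * (a' - a)) by rewrite leq_mul2l za orbT.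
have cq : (2 * c + 7) * q ^ 2 <= (2 * c + 7) * (6 * (d' - d)) by rewrite leq_mul2l qd orbT.
move: (a' - a) (d' - d) (new_component_time _ _ _) (q ^ 2) time ct q2 nz cq thW.
clear => da dd nt q2 time ct q_q2 nz cq thW.
have : t <= 4 * th + (2 * c + 7) * q2 + 3 by move: time ct q_q2; clear; nia.
move: thW nz cq; move: ((2 * c + 7) * q2) => cq2; clear; lia.
Qed.

Lemma add_arc_step : exists t s', [/\ add_arc scc s v0 w0 t s', valid E' s' &
  forall psi b, (forall x, psi x <= b) ->
    (forall x y, connect E' x y -> ~~ connect E' y x -> psi x <= psi y) ->
    t + potential c psi b E s <= potential c psi b E' s' + 14].
Proof.
have [vw|vw] := eqVneq v w.
  exists 3, s; split=> [||psi b psi_b psi_mono]; [exact: AddInside|exact: valid_inside|].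
  by rewrite addnC; apply: leq_add (potential_weaken psi b) _.
have [le|wv] := leqP (pos v) (pos w).
  exists 5, (set_arc s v w); split=> [||psi b psi_b psi_mono].
  - by apply: AddOrdered => //; apply/eqP.
  - by apply: valid_set_arc => //; apply/eqP.
  - by rewrite addnC; apply: leq_add (potential_weaken psi b) _.
have Lv := live_canon sV v0; have Lw := live_canon sV w0.
have [t [vtx' [pos' [F [B [k [run re time]]]]]]] :=
  search_and_reorder_run sV Lv Lw wv scc.
case comp: (new_component scc (F ++ B) A) => [D|]; rewrite -/A comp in run.
  have [wvE D_uniq D2 D_mem] := some_component sV Lv Lw re sccP comp.
  have vk : vtx' k = Some w by apply/(re_vertex re); split=> //; apply: re_root re.
  have cardD := card_live_contract sV vtx' wvE D_uniq D_mem; rewrite -/A in cardD.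
  exists (11 + t + contract_time D), (contract (canon s) vtx' A D w); split.
  - by apply: AddCyclic run vk => //; apply/eqP.
  - exact: (valid_contract sV wv re wvE D_uniq D_mem).
  move=> psi b psi_b psi_mono.
  have := search_time psi_b psi_mono wv re D_uniq D_mem time.
  have := weight_contract psi_b wv re wvE D_uniq D_mem erefl.
  have sn := live_n s; rewrite /potential /contract_time.
  move: (contract _ _ _ _ _) cardD => st cardD.
  have tn := live_n st.
  move: (weight _ (live s) pos) (weight _ (live s) pos') (weight _ (live st) _) => W W1 W2.
  move: (8 * n * _) (8 * n * _) (6 * _ * _) (6 * _ * _) => a a' d d'.
  move: #|live s| #|live st| (size D) D2 cardD sn tn => m m' q D2 cardD sn tn h1 h2.
  clear -D2 cardD sn tn h1 h2.
  have -> : n - m' = n - m + (q - 1) by move: D2 sn tn cardD; clear; lia.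
  rewrite !mulnDr.
  (* The terms in [q * (b * n)] add up to 8 + 16 = 24, and [q <= 2 * (q - 1)] for [q >= 2] doubles
     this to 48. *)
  have key : 4 * (q * ((2 * b + 1) * n)) + 16 * (q * (b * n)) + (q.-1 + q * (2 * n) + n) <=
     48 * (n * (b + 1)) * (q - 1).
    have : 0 < n by move: sn cardD D2 tn; clear; lia.
    case: q D2 {cardD h1 h2} => [|[|q]] // _ n_gt0; rewrite subn1 /=.
    by move: n_gt0; clear; nia.
  move: key h1 h2; rewrite !mulnDr.
  move: (48 * (n * b) * (n - m)) => u; clear; lia.
have nwv := no_component sV Lv Lw wv re sccP comp.
exists (11 + t), (State (canon s) pos' vtx' A); split.
- by apply: AddAcyclic run => //; apply/eqP.
- exact: (valid_acyclic sV re nwv).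
move=> psi b psi_b psi_mono.
(* Without a cycle no vertex is [between], so the same estimate holds with an empty component. *)
have D_mem x : (x \in [::]) = between E s v w x.
  by rewrite in_nil; apply/esym/negP => /and3P[_ wx xv]; rewrite (connect_trans wx xv) in nwv.
have := search_time psi_b psi_mono wv re (isT : uniq [::]) D_mem time.
rewrite /potential mul0n muln0 addn0 /=.
rewrite -[live (State _ _ _ _)]/(live s) -[X in _ -> _ <= 8 * weight _ _ X + _ + _ + _ + _]/pos'.
move: (weight _ _ pos) (weight _ _ pos') (8 * n * _) (8 * n * _) (6 * _ * _) (6 * _ * _).
by move=> W W' a a' d d'; clear; lia.
Qed.

End Step.

Lemma valid_initial n (sigma : {perm 'I_n}) : valid (arc_rel [::]) (initial sigma).
Proof.
have Lall : #|live (initial sigma)| = n.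
  by rewrite -[RHS]card_ord; apply: eq_card => x; rewrite /live unfold_in /= eqxx.
split=> //.
- by move=> x; rewrite connect0.
- move=> p x /=; case: pickP => [y /eqP yp|none].
    split=> [[<-]|[_ xp]]; first by rewrite /live /= eqxx.
    by congr Some; apply: (@perm_inj _ sigma); apply: val_inj; move: yp xp => <- [].
  by split=> // -[_ xp]; have := none x; rewrite xp eqxx.
- by move=> x _; rewrite Lall /=.
Qed.

(** * Summing over all additions *)

Section Run.
Variables (n c : nat) (scc : seq 'I_n -> rel 'I_n -> seq (seq 'I_n) * nat).
Hypothesis sccP : linear_time_scc c scc.

(** The list [catrev past future] is the same at every step of the run, so one [psi], monotone at
    each cut of that list, serves all steps. *)
Lemma add_arcs_run future past s : valid (arc_rel past) s ->
  exists t s' E', [/\ add_arcs scc s future t s', valid E' s' &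
  forall psi b, (forall x, psi x <= b) ->
    (forall past' future' x y, catrev past' future' = catrev past future ->
       connect (arc_rel past') x y -> ~~ connect (arc_rel past') y x ->
       psi x <= psi y) ->
    t + potential c psi b (arc_rel past) s <=
    potential c psi b E' s' + 14 * size future].
Proof.
elim: future past s => [|[v w] future IH] past s sV.
  by exists 0, s, (arc_rel past); split=> //; [exact: AddNil|move=> *; rewrite addn0].
have [t1 [s1 [run1 s1V time1]]] := add_arc_step v w sV sccP.
have [t2 [s2 [E' [run2 s2V time2]]]] := IH ((v, w) :: past) s1 s1V.
exists (t1 + t2), s2, E'; split=> //; first exact: AddCons run1 run2.
move=> psi b psi_b psi_mono.
have := time1 psi b psi_b (fun x y => psi_mono ((v, w) :: past) future x y erefl).
have := time2 psi b psi_b psi_mono.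
rewrite -[arc_rel ((v, w) :: past)]/(add_rel (arc_rel past) v w) /= mulnS.
move: (potential _ _ _ _ s) (potential _ _ _ _ s1) (potential _ _ _ _ s2).
by move: (14 * size future); clear; lia.
Qed.

(** Within a block the rank is determined by its remainder modulo [q]. *)
Lemma block_size (r : 'I_n -> nat) q (x : 'I_n) : 0 < q -> injective r ->
  #|[set y : 'I_n | r y %/ q == r x %/ q]| <= q.
Proof.
move=> q_gt0 r_inj; pose f y : 'I_q := Ordinal (ltn_pmod (r y) q_gt0).
have f_inj : {in [set y | r y %/ q == r x %/ q] &, injective f}.
  move=> y z; rewrite !inE => /eqP yx /eqP zx /(congr1 val)/= yz; apply: r_inj.
  by rewrite (divn_eq (r y) q) (divn_eq (r z) q) yx zx yz.
by rewrite -(card_in_imset f_inj) -[X in _ <= X]card_ord max_card.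
Qed.

Lemma potential_bound (psi : 'I_n -> nat) b q E s : valid E s -> (forall x, psi x <= b) ->
  (forall x, #|[set y : 'I_n | psi y == psi x]| <= q) ->
  potential c psi b E s <=
  8 * (n ^ 2 * b) + 8 * (n ^ 2 * q) + 6 * (2 * c + 7) * n ^ 2 + 48 * (n ^ 2 * (b + 1)).
Proof.
move=> sV psi_b psi_q; rewrite /potential -!mulnn.
have w_le : weight psi (live s) (position s) <= n * n * b.
  apply: (@leq_trans (\sum_(x : 'I_n) b * n)); last first.
    by rewrite sum_nat_const card_ord -mulnA leq_mul2l mulnC leqnn orbT.
  rewrite /weight big_mkcond; apply: leq_sum => x _; case: ifP => // Lx.
  apply: leq_mul (psi_b x) _; have := position_range sV Lx; have := live_n s; clear; lia.
have r_le : related predT E <= n * n.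
  by apply: leq_trans (max_card _) _; rewrite card_prod card_ord.
have b_le : related (same_block psi) E <= n * q.
  apply: (@leq_trans #|[set p : 'I_n * 'I_n | psi p.2 == psi p.1]|).
    by apply/subset_leq_card/subsetP => -[x y]; rewrite !inE /same_block /= eq_sym => /andP[].
  rewrite -sum1_card (eq_bigl (fun p : 'I_n * 'I_n => true && (psi p.2 == psi p.1))); last first.
    by move=> p; rewrite inE.
  rewrite -(pair_big_dep predT (fun x y => psi y == psi x) (fun _ _ => 1)) /=.
  apply: (@leq_trans (\sum_(x : 'I_n) q)); last by rewrite sum_nat_const card_ord.
  by apply: leq_sum => x _; rewrite sum1_card; have := psi_q x; rewrite cardsE.
apply: leq_add; last first.
  by rewrite -mulnA leq_mul2l [n * n * _]mulnAC leq_mul ?leq_subr ?orbT.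
apply: leq_add; last by rewrite leq_mul2l r_le orbT.
apply: leq_add; first by rewrite leq_mul2l w_le orbT.
by rewrite -mulnA leq_mul2l -mulnA leq_mul2l b_le !orbT.
Qed.

(** Ranks are below [n <= q * q], so [b = q] bounds the block numbers. Then 168 is 8 + 8 + 42 + 96 +
    14: weight, block pairs, all pairs, deletions with [q + 1 <= 2 * q], and the fixed cost of at
    most [n ^ 2] additions. *)
Lemma total_time (sigma : {perm 'I_n}) arcs : uniq arcs ->
  exists t s, add_arcs scc (initial sigma) arcs t s /\
  forall q, 0 < q -> n <= q * q -> t <= (168 + 12 * c) * (n ^ 2 * q).
Proof.
move=> arcs_uniq; have [r [r_inj r_n r_mono]] := topological_rank arcs.
have [t [s [E' [run sV time]]]] := add_arcs_run arcs (valid_initial sigma).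
exists t, s; split=> // q q_gt0 nq.
have psi_b x : r x %/ q <= q.
  by rewrite -ltnS ltn_divLR // (leq_trans (r_n x)) // (leq_trans nq) // leq_mul2r leqnSn orbT.
have := time _ _ psi_b (fun past future x y e xy yx =>
  leq_div2r q (ltnW (r_mono past future x y e xy yx))).
have := potential_bound sV psi_b (fun x => block_size x q_gt0 r_inj).
have : size arcs <= n ^ 2.
  by rewrite -(card_uniqP arcs_uniq) (leq_trans (max_card _)) // card_prod card_ord mulnn.
move: (potential _ _ _ E' s) (potential _ _ _ _ (initial sigma)) (size arcs) (n ^ 2) q_gt0.
clear => p p0 m n2 q_gt0 m_le p_le t_le; nia.
Qed.

End Run.

(** For the least [q] with [n <= q * q], either [q = 1] or [q <= 2 * (q - 1)] with the square of
    [q - 1] below [n]. *)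
Lemma nat_sqrt_approx n : 0 < n -> exists q, [/\ 0 < q, n <= q * q & q * q <= 4 * n].
Proof.
move=> n_gt0; have ex : exists q, n <= q * q by exists n; rewrite leq_pmulr.
case: (ex_minnP ex) => q nq q_min; exists q.
have q_gt0 : 0 < q by case: q nq {q_min} => //; rewrite leqNgt n_gt0.
split=> //; have [q1|q_gt1] := leqP q 1.
  by apply: (@leq_trans 1); [rewrite (@leq_mul q q 1 1)|rewrite muln_gt0].
have : q.-1 * q.-1 < n by rewrite ltnNge; apply/negP => /q_min; rewrite -ltnS prednK ?ltnn.
by case: q q_gt1 {nq q_min q_gt0} => [|[|q]] // _ /=; clear; nia.
Qed.

(* The bound with a real exponent *)
From mathcomp Require Import all_classical all_reals all_analysis.
From mathcomp Require Import lra.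
Local Open Scope ring_scope.

Lemma powR_five_halves (R : realType) (x : R) : 0 <= x ->
  x `^ (5%:R / 2%:R) = x ^+ 2 * Num.sqrt x.
Proof.
move=> x_ge0; have -> : 5%:R / 2%:R = 2%:R + 2^-1 :> R by lra.
by rewrite powRD ?powR_mulrn ?powR12_sqrt //; apply/implyP => /eqP; lra.
Qed.

Theorem theorem6p6 (R : realType) (c : nat) :
  exists C : R,
  forall (n : nat) (scc : seq 'I_n -> rel 'I_n -> seq (seq 'I_n) * nat)
    (order : {perm 'I_n}) (arcs : seq ('I_n * 'I_n)),
    linear_time_scc c scc -> uniq arcs ->
    (exists (t : nat) (s : state n), add_arcs scc (initial order) arcs t s) /\
    (forall (t : nat) (s : state n), add_arcs scc (initial order) arcs t s ->
       t%:R <= C * n%:R `^ (5%:R / 2%:R)).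
Proof.
(* The factor 2 comes from [q * q <= 4 * n], that is, [q] is at most twice the square root of
   [n]. *)
exists ((168 + 12 * c) * 2)%N%:R => n scc order arcs sccP arcs_uniq.
have [t [s [run bound]]] := total_time sccP order arcs_uniq.
split=> [|t' s' /(add_arcs_det run)[<- _]]; first by exists t, s.
rewrite powR_five_halves ?ler0n //.
have [n0|n_gt0] := posnP n.
  have := bound 1%N isT; rewrite n0 => /(_ isT).
  by rewrite muln1 muln0 leqn0 => /eqP ->; rewrite expr0n mul0r mulr0.
have [q [q_gt0 nq qn]] := nat_sqrt_approx n_gt0.
apply: (@le_trans _ _ ((168 + 12 * c) * (n ^ 2 * q))%N%:R).
  by rewrite ler_nat bound.
rewrite !(natrM _ (168 + 12 * c)%N) [(n ^ 2 * q)%:R]natrM natrX -mulrA.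
rewrite ler_wpM2l ?ler0n // mulrCA ler_wpM2l ?exprn_ge0 ?ler0n //.
rewrite -ler_sqr ?nnegrE ?mulr_ge0 ?sqrtr_ge0 ?ler0n // exprMn sqr_sqrtr ?ler0n //.
by rewrite -!natrX -natrM ler_nat -mulnn.
Qed.
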